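(* Let $p\in(2,\infty)$ and $B\neq\emptyset$. Then the function $$\mathcal E_{p,1}(\mu,\nu)=\frac{1}{\lambda_{(\mu,\nu),1}}+\frac{p-2}{p}\sum_{(u,v)\in\tilde E}\mu_{uv}^{\frac{p}{p-2}}-\frac{p-2}{p}\sum_{u\in V\setminus B}\nu_u^{\frac{p}{p-2}}$$ admits a unique saddle point $$(\mu^*,\nu^* )=\operatorname*{arg\,max}_{\nu\in\mathcal M^+(V\setminus B)\setminus\{0\}}\ \operatorname*{arg\,min}_{\mu\in\mathcal M^+(E)}\ \mathcal E_{p,1}(\mu,\nu).$$ Moreover, if $\lambda_{(\mu^*,\nu^* ),1}$ is the first eigenvalue of the weighted Laplacian eigenvalue problem $\Delta_{\mu^*}f=\lambda\,\mathrm{diag}(\nu^* )f$, then there exists an associated eigenfunction $f_{(\mu^*,\nu^* ),1}$ such that $\big(\lambda_{(\mu^*,\nu^* ),1}^{p/2},f_{(\mu^*,\nu^* ),1}\big)$ equals the first $p$-Laplacian eigenpair.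
   Context: $G=(V,E,\omega)$ is a finite non-oriented graph: $(u,v)\in E$ iff $(v,u)\in E$, with positive weights $\omega_{uv}=\omega_{vu}$. $B\subset V$ is the boundary and $V\setminus B$ the internal nodes. $G$ is assumed connected, meaning that the subgraph induced by $V\setminus B$ is connected; moreover, when $B\ne\emptyset$ at least one edge joins an internal node to $B$ (equivalently, $\ker\nabla=\{0\}$ for the operator below). $\tilde E\subset E$ contains exactly one orientation of each edge. For $f\in\mathcal H(V\setminus B)=\{f:V\setminus B\to\mathbb R\}$, extended by $0$ on $B$, set $\nabla f(u,v)=\omega_{uv}(f(v)-f(u))$, a linear map to real functions on $\tilde E$ with transpose $\nabla^T$. $\mathcal M^+(E)$ and $\mathcal M^+(V\setminus B)$ are the sets of nonnegative functions on $\tilde E$ and on $V\setminus B$. For $\mu\in\mathcal M^+(E)$, $\nu\in\mathcal M^+(V\setminus B)$: $\Delta_\mu=\nabla^T\mathrm{diag}(\mu)\nabla$; $\lambda_{(\mu,\nu),1}\in[0,\infty]$ is the minimum of $\mathcal R_{2,\mu,\nu}(g)=\sum_{(u,v)\in\tilde E}\mu_{uv}|\nabla g(u,v)|^2\big/\sum_{u}\nu_u|g(u)|^2$ (value $+\infty$ if only the denominator vanishes) over nonzero $g\in(\ker\mathrm{diag}(\nu)\cap\ker\Delta_\mu)^\perp$, with $1/0=+\infty$, $1/\infty=0$. The saddle point notation means: $\nu^*$ maximizes $\nu\mapsto\min_{\mu\in\mathcal M^+(E)}\mathcal E_{p,1}(\mu,\nu)$ over $\mathcal M^+(V\setminus B)\setminus\{0\}$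 and $\mu^*$ minimizes $\mathcal E_{p,1}(\cdot,\nu^* )$ over $\mathcal M^+(E)$. $p$-Laplacian: $\Delta_pf=\nabla^T(|\nabla f|^{p-2}\odot\nabla f)$ (entrywise operations), with eigenpairs $(\lambda,f)$, $f\neq 0$, $\Delta_pf=\lambda|f|^{p-2}f$ on $V\setminus B$. The first $p$-Laplacian eigenpair consists of the minimum value and the minimizer (unique up to scalar multiples) over $f\ne0$ of $\mathcal R_p(f)=\sum_{(u,v)\in\tilde E}|\nabla f(u,v)|^p\big/\sum_{u\in V\setminus B}|f(u)|^p$. Eigenfunctions are identified up to nonzero scalar multiples. *)

(* Defs.v *)
From HB Require Import structures.
From mathcomp Require Import all_boot all_order all_algebra.
From mathcomp Require Import all_classical all_reals all_analysis.
Set Implicit Arguments.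
Unset Strict Implicit.
Unset Printing Implicit Defensive.
Import Order.TTheory GRing.Theory Num.Theory.
Local Open Scope classical_set_scope.
Local Open Scope ring_scope.

(* [oriented] contains exactly one of (u, v), (v, u) for each edge; a loop
   (u, u), which the definition of a graph does not exclude, is its own only
   orientation. The values of [weight] outside [edges] play no role. *)
Record wgraph (R : realType) := WGraph {
  vertex : finType;
  edges : {set vertex * vertex};
  weight : vertex -> vertex -> R;
  boundary : {set vertex};
  oriented : {set vertex * vertex};
  edges_sym : forall u v, ((u, v) \in edges) = ((v, u) \in edges);
  weight_gt0 : forall u v, (u, v) \in edges -> 0 < weight u v;
  weight_sym : forall u v, (u, v) \in edges -> weight u v = weight v u;
  orientedE : forall u v,
    ((u, v) \in edges) = ((u, v) \in oriented) || ((v, u) \in oriented);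
  oriented_anti : forall u v,
    (u, v) \in oriented -> (v, u) \in oriented -> u = v }.

Arguments edges {R} _.
Arguments weight {R} _ _ _.
Arguments boundary {R} _.
Arguments oriented {R} _.

Section Graph.
Context {R : realType} (G : wgraph R).

Definition graph_connected : Prop :=
  (forall u v : vertex G, u \notin boundary G -> v \notin boundary G ->
     connect (fun x y => [&& x \notin boundary G, y \notin boundary G
                           & (x, y) \in edges G]) u v) /\
  (boundary G != finset.set0 ->
     exists u v : vertex G,
       [/\ u \notin boundary G, v \in boundary G & (u, v) \in edges G]).

Definition inode : finType := {u : vertex G | u \notin boundary G}.

Definition oedge : finType := {e : vertex G * vertex G | e \in oriented G}.

Definition ext0 (f : {ffun inode -> R}) (v : vertex G) : R :=
  if insub v is Some u then f u else 0.

Definition grad (f : {ffun inode -> R}) : {ffun oedge -> R} :=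
  [ffun e => let: (u, v) := val e in
             weight G u v * (ext0 f v - ext0 f u)].

(* The matrix of [grad] in the canonical bases has entry
   [grad (delta u) e] at (e, u). *)
Definition gradT (phi : {ffun oedge -> R}) : {ffun inode -> R} :=
  [ffun u => \sum_(e : oedge) grad [ffun v => (v == u)%:R] e * phi e].

Definition lap_mu (mu : {ffun oedge -> R}) (f : {ffun inode -> R}) :
    {ffun inode -> R} :=
  gradT [ffun e => mu e * grad f e].

Definition diag_nu (nu f : {ffun inode -> R}) : {ffun inode -> R} :=
  [ffun u => nu u * f u].

(* At a function where numerator and denominator both vanish the value is
   irrelevant: [lambda1] never evaluates the quotient there. *)
Definition rayleigh2 (mu : {ffun oedge -> R}) (nu g : {ffun inode -> R}) :
    \bar R :=
  let den := \sum_u nu u * `|g u| ^+ 2 in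
  if den == 0 then +oo%E
  else ((\sum_e mu e * `|grad g e| ^+ 2) / den)%:E.

(* Orthogonal complement of the common kernel of diag(nu) and Delta_mu. *)
Definition ker_perp (mu : {ffun oedge -> R}) (nu : {ffun inode -> R}) :
    set {ffun inode -> R} :=
  [set g | forall h, diag_nu nu h = 0 -> lap_mu mu h = 0 ->
                     \sum_u g u * h u = 0].

Definition lambda1 (mu : {ffun oedge -> R}) (nu : {ffun inode -> R}) :
    \bar R :=
  ereal_inf [set rayleigh2 mu nu g | g in [set g | g != 0 /\ ker_perp mu nu g]].

Definition Mplus (T : finType) : set {ffun T -> R} :=
  [set m | forall x, 0 <= m x].

Arguments Mplus T _ : clear implicits.

(* The inverse of \bar R satisfies 0^-1 = +oo and +oo^-1 = 0. *)
Definition energy (p : R) (mu : {ffun oedge -> R}) (nu : {ffun inode -> R}) :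
    \bar R :=
  ((lambda1 mu nu)^-1
   + ((p - 2) / p * (\sum_e mu e `^ (p / (p - 2))))%:E
   - ((p - 2) / p * (\sum_u nu u `^ (p / (p - 2))))%:E)%E.

Definition min_energy (p : R) (nu : {ffun inode -> R}) : \bar R :=
  ereal_inf [set energy p mu nu | mu in Mplus oedge].

(* [nu] maximizes the inner minimum and [mu] minimizes for that [nu]; no
   two-sided saddle inequality is required. *)
Definition saddle_point (p : R)
    (s : {ffun oedge -> R} * {ffun inode -> R}) : Prop :=
  let: (mu, nu) := s in
  [/\ Mplus inode nu, nu != 0,
      forall nu', Mplus inode nu' -> nu' != 0 ->
        (min_energy p nu' <= min_energy p nu)%E,
      Mplus oedge mu
    & forall mu', Mplus oedge mu' -> (energy p mu nu <= energy p mu' nu)%E].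

Definition weighted_eigenpair (mu : {ffun oedge -> R})
    (nu : {ffun inode -> R}) (l : R) (f : {ffun inode -> R}) : Prop :=
  f != 0 /\ lap_mu mu f = l *: diag_nu nu f.

Definition plap (p : R) (f : {ffun inode -> R}) : {ffun inode -> R} :=
  gradT [ffun e => `|grad f e| `^ (p - 2) * grad f e].

Definition p_eigenpair (p l : R) (f : {ffun inode -> R}) : Prop :=
  f != 0 /\ plap p f = [ffun u => l * (`|f u| `^ (p - 2) * f u)].

Definition rayleigh (p : R) (f : {ffun inode -> R}) : R :=
  (\sum_e `|grad f e| `^ p) / (\sum_u `|f u| `^ p).

Definition first_p_eigenpair (p l : R) (f : {ffun inode -> R}) : Prop :=
  [/\ p_eigenpair p l f,
      rayleigh p f = l,
      forall g, g != 0 -> l <= rayleigh p g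
    & forall g, g != 0 -> rayleigh p g = l ->
        exists2 c : R, c != 0 & g = c *: f].

End Graph.

(* Main.v *)
Require Import Defs.
From mathcomp Require Import all_boot all_order all_algebra.
From mathcomp Require Import all_classical all_reals all_analysis.
From mathcomp Require Import ring lra.
Import Order.TTheory GRing.Theory Num.Theory.
Import numFieldNormedType.Exports.
Local Open Scope ring_scope.

Set Implicit Arguments.
Unset Strict Implicit.
Unset Printing Implicit Defensive.

(** Write q = p / (p - 2) and, for a node function g, D(g) = [dirichlet p g] for
    the sum of |grad g|^p, N(g) = [wmass nu g] for the sum of nu |g|^2,
    T(g) = [wdirichlet mu g] for the sum of mu |grad g|^2 and
    J(g) = 2 sqrt(N(g)) - (2/p) D(g), which is [gain].

    The inner minimum is the maximum of J. For every g,
    1 / lambda >= N / T >= 2 sqrt(N) - T, and Young's inequality bounds T by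
    ((p - 2) / p) sum mu^q + (2/p) D(g); hence the energy of (mu, nu) is at
    least J(g) - ((p - 2) / p) sum nu^q ([energy_ge_gain]). A maximizer g of J
    exists by compactness and may be replaced by |g|. Its Euler-Lagrange
    equation is Delta_p g = (nu / sqrt N) g, so g > 0 by the strong maximum
    principle. For mu = |grad g|^(p-2) the same equation says that g is a
    positive eigenfunction of the weighted problem; by Picone's inequality a
    positive eigenfunction belongs to the first eigenvalue, so lambda is
    1 / sqrt N and the lower bound is attained ([min_energy_critical]).

    The outer maximum is 1 / l, where l^(p/2) is the least value of the
    p-Rayleigh quotient. It results from chaining three inequalities
    ([gain_le]):
      2 sqrt N <= 1 / l + l N,
      l N <= ((p - 2) / p) sum nu^q + (2/p) l^(p/2) sum |g|^p   (Young),
      l^(p/2) sum |g|^p <= D(g).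
    All three are equalities when g is a first p-eigenfunction f, suitably
    scaled, and nu = |sqrt(l) f|^(p-2). So f maximizes J for this nu, and the
    Euler-Lagrange equation above is at once the p-Laplacian eigenvalue equation
    of f and the weighted eigenvalue equation with lambda = l.

    Uniqueness is the study of equality. If nu is optimal and g maximizes its J,
    then equality in the chain makes g a minimizer of the p-Rayleigh quotient
    ([gain_eq]), hence a multiple of f by the equality case of Picone's
    inequality for powers ([ground_state_unique]), and determines nu from g; an
    optimal mu gives equality in Young's inequality against f, which determines
    mu ([saddle_point_unique]). *)

(** * Young's inequality and its equality case *)
Section PowerInequalities.
Context {R : realType}.
Implicit Types a b t p x y : R.

(** Both factors are exponentials, and the tangent to exp at the weighted mean of
    the logarithms lies strictly below exp at each logarithm. *)
Lemma weighted_amgm_lt t a b : 0 < t -> t < 1 -> 0 <= a -> 0 <= b -> a != b ->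
  a `^ t * b `^ (1 - t) < t * a + (1 - t) * b.
Proof.
move=> t0 t1 a0 b0 ab; have t1' : 0 < 1 - t by lra.
have [aE|aN0] := eqVneq a 0.
  rewrite aE powR0 ?gt_eqF// mul0r mulr0 add0r mulr_gt0// lt_neqAle b0 andbT.
  by rewrite -aE.
have [bE|bN0] := eqVneq b 0.
  by rewrite bE powR0 ?gt_eqF// !mulr0 addr0 mulr_gt0// lt_neqAle eq_sym aN0.
have {}a0 : 0 < a by rewrite lt_neqAle eq_sym aN0.
have {}b0 : 0 < b by rewrite lt_neqAle eq_sym bN0.
have lnab : ln a - ln b != 0.
  by rewrite subr_eq0; apply: contra ab => /eqP /ln_inj ->.
rewrite /powR (negbTE aN0) (negbTE bN0) -expRD.
set z := t * ln a + (1 - t) * ln b.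
have tangent (w : R) : w != z -> expR z * (1 + (w - z)) < expR w.
  move=> wz; have -> : expR w = expR z * expR (w - z) by rewrite -expRD subrKC.
  by rewrite ltr_pM2l ?expR_gt0// expR_gt1Dx// subr_eq0.
have az : ln a != z.
  rewrite -subr_eq0 (_ : _ - _ = (1 - t) * (ln a - ln b)); last by rewrite /z; ring.
  by rewrite mulf_neq0// gt_eqF.
have bz : ln b != z.
  rewrite -subr_eq0 (_ : _ - _ = (- t) * (ln a - ln b)); last by rewrite /z; ring.
  by rewrite mulf_neq0// oppr_eq0 gt_eqF.
have := tangent _ az; have := tangent _ bz.
rewrite !lnK ?posrE// => hb ha.
have -> : expR z =
    t * (expR z * (1 + (ln a - z))) + (1 - t) * (expR z * (1 + (ln b - z))).
  by rewrite /z; ring.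
by apply: ltrD; rewrite ltr_pM2l.
Qed.

Lemma weighted_amgm_le t a b : 0 < t -> t < 1 -> 0 <= a -> 0 <= b ->
  a `^ t * b `^ (1 - t) <= t * a + (1 - t) * b.
Proof.
move=> t0 t1 a0 b0; have [<-|ab] := eqVneq a b; last first.
  exact/ltW/weighted_amgm_lt.
by rewrite -powRD ?subrKC ?oner_eq0// powRr1// -mulrDl subrKC mul1r.
Qed.

Lemma powRrK x p : 0 <= x -> p != 0 -> (x `^ p) `^ p^-1 = x.
Proof. by move=> x0 p0; rewrite -powRrM mulfV// powRr1. Qed.

(** Weighted AM-GM between x^p and y^p with weight 1/p. *)
Lemma powR_tangent_le p x y : 1 < p -> 0 <= x -> 0 <= y ->
  y `^ p + p * y `^ (p - 1) * (x - y) <= x `^ p.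
Proof.
move=> p1 x0 y0; have p0 : 0 < p by lra.
have := @weighted_amgm_le p^-1 (x `^ p) (y `^ p).
rewrite invr_gt0 invf_lt1// !powR_ge0 => /(_ p0 p1 erefl erefl).
rewrite powRrK ?gt_eqF// -powRrM mulrBr mulr1 mulfV ?gt_eqF// => H.
have H2 : p * (x * y `^ (p - 1)) <= x `^ p + (p - 1) * y `^ p.
  have := ler_wpM2l (ltW p0) H; rewrite mulrDr !mulrA mulfV ?gt_eqF// mul1r.
  by rewrite mulrBr mulr1 mulfV ?gt_eqF// mulrA.
have := mulr_powRB1 y0 p0; nra.
Qed.

Lemma powR_tangent_eq p x y : 1 < p -> 0 <= x -> 0 <= y ->
  x `^ p <= y `^ p + p * y `^ (p - 1) * (x - y) -> x = y.
Proof.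
move=> p1 x0 y0 H; have p0 : 0 < p by lra.
apply/eqP/negP => /negP xy.
have xpyp : x `^ p != y `^ p.
  by apply: contra xy => /eqP /(powR_injective p0) ->; rewrite ?nnegrE.
have := @weighted_amgm_lt p^-1 (x `^ p) (y `^ p).
rewrite invr_gt0 invf_lt1// !powR_ge0 => /(_ p0 p1 erefl erefl xpyp).
rewrite powRrK ?gt_eqF// -powRrM mulrBr mulr1 mulfV ?gt_eqF// => H1.
have H2 : p * (x * y `^ (p - 1)) < x `^ p + (p - 1) * y `^ p.
  move: H1; rewrite -(ltr_pM2l p0) mulrDr !mulrA mulfV ?gt_eqF// mul1r.
  by rewrite mulrBr mulr1 mulfV ?gt_eqF// mulrA.
have := mulr_powRB1 y0 p0; nra.
Qed.

End PowerInequalities.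

(** * Inequalities on a single edge *)
Section EdgeInequalities.
Context {R : realType} (p : R).
Implicit Types a b t x y : R.

Definition signed_powR x := `|x| `^ (p - 2) * x.

(** Weighted AM-GM between x^(p/(p-2)) and y^(p/2) with weight (p-2)/p. *)
Lemma young_half_le (hp : 2 < p) x y : 0 <= x -> 0 <= y ->
  x * y <= (p - 2) / p * x `^ (p / (p - 2)) + 2 / p * y `^ (p / 2).
Proof.
move=> x0 y0; have p0 : 0 < p by lra.
have := @weighted_amgm_le R ((p - 2) / p) (x `^ (p / (p - 2))) (y `^ (p / 2)).
have -> : 1 - (p - 2) / p = 2 / p by field; lra.
rewrite !powR_ge0 ltr_pdivrMr// mul1r divr_gt0 ?subr_gt0// => /(_ erefl).
rewrite -!powRrM => /(_ _ erefl erefl).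
have -> : p / (p - 2) * ((p - 2) / p) = 1 by field; lra.
have -> : p / 2 * (2 / p) = 1 by field; lra.
by rewrite !powRr1//; apply; lra.
Qed.

Lemma young_half_eq (hp : 2 < p) x y : 0 <= x -> 0 <= y ->
  (p - 2) / p * x `^ (p / (p - 2)) + 2 / p * y `^ (p / 2) <= x * y ->
  x = y `^ ((p - 2) / 2).
Proof.
move=> x0 y0 H; have p0 : 0 < p by lra.
have [E|N] := eqVneq (x `^ (p / (p - 2))) (y `^ (p / 2)).
  have q0 : 0 < p / (p - 2) by rewrite divr_gt0// subr_gt0.
  apply: (powR_injective q0); rewrite ?nnegrE ?powR_ge0//.
  by rewrite E -powRrM; congr (_ `^ _); field; lra.
suff : x * y < x * y by rewrite ltxx.
apply: lt_le_trans H.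
have := @weighted_amgm_lt R ((p - 2) / p) (x `^ (p / (p - 2))) (y `^ (p / 2)).
have -> : 1 - (p - 2) / p = 2 / p by field; lra.
rewrite !powR_ge0 ltr_pdivrMr// mul1r divr_gt0 ?subr_gt0// => /(_ erefl).
rewrite -!powRrM => /(_ _ erefl erefl N).
have -> : p / (p - 2) * ((p - 2) / p) = 1 by field; lra.
have -> : p / 2 * (2 / p) = 1 by field; lra.
by rewrite !powRr1//; apply; lra.
Qed.

Lemma normr_signed_powR (hp : 2 < p) x : `|signed_powR x| = `|x| `^ (p - 1).
Proof.
rewrite /signed_powR normrM (ger0_norm (powR_ge0 _ _)) mulrC.
have -> : p - 2 = (p - 1) - 1 by ring.
by rewrite mulr_powRB1 ?normr_ge0//; lra.
Qed.

Lemma signed_powRN x : signed_powR (- x) = - signed_powR x.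
Proof. by rewrite /signed_powR normrN mulrN. Qed.

Lemma signed_powR_ge0 (hp : 2 < p) x : 0 <= x -> signed_powR x = x `^ (p - 1).
Proof.
move=> x0; rewrite -{2}(ger0_norm x0) -(normr_signed_powR hp).
rewrite ger0_norm// /signed_powR.
by rewrite mulr_ge0 ?powR_ge0.
Qed.

Lemma signed_powR_mulr (hp : 2 < p) x : signed_powR x * x = `|x| `^ p.
Proof.
rewrite /signed_powR -mulrA -expr2 -real_normK ?num_real// -powR_mulrn//.
by rewrite -powRD ?subrK//; apply/implyP => /eqP; lra.
Qed.

Lemma signed_powRM (hp : 2 < p) c x : 0 <= c ->
  signed_powR (c * x) = c `^ (p - 1) * signed_powR x.
Proof.
move=> c0; have p1 : 0 < p - 1 by lra.
rewrite /signed_powR normrM powRM// (ger0_norm c0) -(mulr_powRB1 c0 p1).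
have -> : p - 1 - 1 = p - 2 by ring.
by ring.
Qed.

(** The graph of |.|^p lies above its tangent at b. *)
Lemma powR_norm_tangent (hp : 2 < p) a b :
  `|b| `^ p <= `|a| `^ p + p * (signed_powR b * (b - a)).
Proof.
have := @powR_tangent_le R p `|a| `|b|.
rewrite !normr_ge0 => /(_ _ erefl erefl) H.
have {}H := H (lt_trans (ltr1n R 2) hp : 1 < p).
have H2 : signed_powR b * a <= `|b| `^ (p - 1) * `|a|.
  by rewrite -(normr_signed_powR hp) -normrM ler_norm.
have p0 : 0 < p by lra.
have E : `|b| `^ (p - 1) * `|b| = `|b| `^ p by rewrite mulrC mulr_powRB1.
have H3 := ler_wpM2l (ltW p0) H2.
have {}E : p * (`|b| `^ (p - 1) * `|b|) = p * `|b| `^ p by rewrite E.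
rewrite mulrBr (signed_powR_mulr hp); lra.
Qed.

(** The difference of the two sides is (a1 b2 - a2 b1)^2 / (b1 b2). *)
Lemma picone_square a1 a2 b1 b2 : 0 < b1 -> 0 < b2 ->
  (b1 - b2) * (a1 ^+ 2 / b1 - a2 ^+ 2 / b2) <= (a1 - a2) ^+ 2.
Proof.
move=> b10 b20; rewrite -subr_ge0.
have -> : (a1 - a2) ^+ 2 - (b1 - b2) * (a1 ^+ 2 / b1 - a2 ^+ 2 / b2) =
  (a1 * b2 - a2 * b1) ^+ 2 / (b1 * b2) by field; rewrite !gt_eqF.
by rewrite divr_ge0 ?sqr_ge0// mulr_ge0// ltW.
Qed.

(** With r = |a1 - a2| / (b1 - b2) and si = |ai| / bi, the right-hand side is
    (b1 - b2)^(p-1) ((b1 - b2) r^p), and the left-hand side is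
    (b1 - b2)^(p-1) (b1 s1^p - b2 s2^p). The triangle inequality bounds b1 s1 by
    b2 s2 + (b1 - b2) r, so the claim is convexity of the p-th power, in the form
    of its tangent at s1. Equality forces s2 = s1 = r; the last equality also
    excludes opposite signs of a1 and a2. *)
Let picone_aux (hp : 2 < p) a1 a2 b1 b2 : 0 < b2 -> b2 < b1 ->
  signed_powR (b1 - b2) * (`|a1| `^ p / b1 `^ (p - 1) - `|a2| `^ p / b2 `^ (p - 1))
    <= `|a1 - a2| `^ p /\
  (`|a1 - a2| `^ p <= signed_powR (b1 - b2) *
     (`|a1| `^ p / b1 `^ (p - 1) - `|a2| `^ p / b2 `^ (p - 1)) ->
   a1 / b1 = a2 / b2).
Proof.
move=> b20 b21; have b10 : 0 < b1 by lra.
have d0 : 0 < b1 - b2 by lra.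
have p0 : 0 < p by lra.
have p1 : 1 < p by lra.
set r := `|a1 - a2| / (b1 - b2); set s1 := `|a1| / b1; set s2 := `|a2| / b2.
have r0 : 0 <= r by rewrite divr_ge0// ltW.
have s10 : 0 <= s1 by rewrite divr_ge0// ltW.
have s20 : 0 <= s2 by rewrite divr_ge0// ltW.
have E a b : 0 < b -> `|a| `^ p / b `^ (p - 1) = b * (`|a| / b) `^ p.
  move=> b0; rewrite powRM ?invr_ge0 ?(ltW b0)// -(powR_inv1 (ltW b0)).
  rewrite -powRrM mulN1r powRN -(mulr_powRB1 (ltW b0) p0).
  by field; rewrite !gt_eqF// powR_gt0.
have ED : `|a1 - a2| `^ p = (b1 - b2) `^ (p - 1) * ((b1 - b2) * r `^ p).
  rewrite mulrA (mulrC _ (b1 - b2)) mulr_powRB1// ?(ltW d0)//.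
  rewrite -powRM ?(ltW d0)//; congr (_ `^ _).
  by rewrite /r; field; rewrite gt_eqF.
rewrite !E// -/s1 -/s2 (signed_powR_ge0 hp) ?(ltW d0)// ED.
have t0 : 0 < (b1 - b2) `^ (p - 1) by rewrite powR_gt0.
have tri : b1 * s1 <= b2 * s2 + (b1 - b2) * r.
  have -> : b1 * s1 = `|a1| by rewrite /s1; field; rewrite gt_eqF.
  have -> : b2 * s2 = `|a2| by rewrite /s2; field; rewrite gt_eqF.
  have -> : (b1 - b2) * r = `|a1 - a2| by rewrite /r; field; rewrite gt_eqF.
  by rewrite -{1}(subrK a2 a1) addrC ler_normD.
have T2 := powR_tangent_le p1 s20 s10.
have Tr := powR_tangent_le p1 r0 s10.
have k0 : 0 <= p * s1 `^ (p - 1) by rewrite mulr_ge0 ?powR_ge0// ltW.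
set k := p * s1 `^ (p - 1) in T2 Tr k0.
have M1 : b2 * (s1 `^ p + k * (s2 - s1)) <= b2 * s2 `^ p by rewrite ler_pM2l.
have M2 : (b1 - b2) * (s1 `^ p + k * (r - s1)) <= (b1 - b2) * r `^ p.
  by rewrite ler_pM2l.
have M3 : k * (b1 * s1) <= k * (b2 * s2 + (b1 - b2) * r) by rewrite ler_wpM2l.
split; first by rewrite ler_pM2l//; lra.
rewrite ler_pM2l// => H.
have e2 : s2 = s1.
  apply: (@powR_tangent_eq R p) => //; rewrite -/k -(ler_pM2l b20); lra.
have er : r = s1.
  apply: (@powR_tangent_eq R p) => //; rewrite -/k -(ler_pM2l d0); lra.
have n1 : `|a1| = s1 * b1 by rewrite /s1; field; rewrite gt_eqF.
have n2 : `|a2| = s1 * b2 by rewrite -e2 /s2; field; rewrite gt_eqF.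
have nd : `|a1 - a2| = s1 * (b1 - b2) by rewrite -er /r; field; rewrite gt_eqF.
have key : a1 * b2 = a2 * b1.
  have q1 : a1 ^+ 2 = (s1 * b1) ^+ 2 by rewrite -n1 real_normK ?num_real.
  have q2 : a2 ^+ 2 = (s1 * b2) ^+ 2 by rewrite -n2 real_normK ?num_real.
  have qd : (a1 - a2) ^+ 2 = (s1 * (b1 - b2)) ^+ 2.
    by rewrite -nd real_normK ?num_real.
  have q12 : a1 * a2 = s1 ^+ 2 * b1 * b2 by lra.
  apply/eqP; rewrite -subr_eq0 -sqrf_eq0; apply/eqP.
  have -> : (a1 * b2 - a2 * b1) ^+ 2 =
    a1 ^+ 2 * b2 ^+ 2 - 2 * (a1 * a2) * b1 * b2 + a2 ^+ 2 * b1 ^+ 2 by ring.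
  by rewrite q1 q2 q12; ring.
by apply/eqP; rewrite eqr_div ?lt0r_neq0//; apply/eqP.
Qed.

Let picone_both (hp : 2 < p) a1 a2 b1 b2 : 0 < b1 -> 0 < b2 ->
  signed_powR (b1 - b2) * (`|a1| `^ p / b1 `^ (p - 1) - `|a2| `^ p / b2 `^ (p - 1))
    <= `|a1 - a2| `^ p /\
  (`|a1 - a2| `^ p <= signed_powR (b1 - b2) *
     (`|a1| `^ p / b1 `^ (p - 1) - `|a2| `^ p / b2 `^ (p - 1)) ->
   a1 / b1 = a2 / b2).
Proof.
move=> b10 b20; have [b12|b21|<-] := ltgtP b1 b2.
- have [H1 H2] := @picone_aux hp a2 a1 _ _ b10 b12.
  rewrite -opprB signed_powRN mulNr -mulrN opprB -(normrN (a1 - a2)) opprB.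
  by split => // /H2 ->.
- exact: (picone_aux hp).
- rewrite subrr /signed_powR mulr0 mul0r; split; first exact: powR_ge0.
  move=> H; have /powR_eq0_eq0/normr0P : `|a1 - a2| `^ p = 0.
    by apply/eqP; rewrite eq_le H powR_ge0.
  by rewrite subr_eq0 => /eqP ->.
Qed.

(** Picone's inequality for the p-Laplacian on an edge. A minimizer may change
    sign a priori, so a1 and a2 are signed. *)
Lemma picone_powR_le (hp : 2 < p) a1 a2 b1 b2 : 0 < b1 -> 0 < b2 ->
  signed_powR (b1 - b2) * (`|a1| `^ p / b1 `^ (p - 1) - `|a2| `^ p / b2 `^ (p - 1))
    <= `|a1 - a2| `^ p.
Proof. by move=> b10 b20; have [] := @picone_both hp a1 a2 b1 b2 b10 b20. Qed.

Lemma picone_powR_eq (hp : 2 < p) a1 a2 b1 b2 : 0 < b1 -> 0 < b2 ->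
  `|a1 - a2| `^ p <= signed_powR (b1 - b2) *
     (`|a1| `^ p / b1 `^ (p - 1) - `|a2| `^ p / b2 `^ (p - 1)) ->
  a1 / b1 = a2 / b2.
Proof. by move=> b10 b20; have [_] := @picone_both hp a1 a2 b1 b2 b10 b20. Qed.

Lemma continuous_powR_norm (q : R) : 0 < q -> continuous (fun x : R => `|x| `^ q).
Proof.
move=> q0 x; have [->|x0] := eqVneq x 0.
  rewrite /continuous_at normr0 powR0 ?gt_eqF//.
  apply/cvgrPdist_lt => e e0; near=> y.
  rewrite sub0r normrN ger0_norm ?powR_ge0//.
  rewrite -(@powRrK R e q^-1) ?invr_eq0 ?gt_eqF// ?ltW// invrK.
  apply: gt0_ltr_powR; rewrite ?nnegrE ?powR_ge0//.
  near: y; apply/nbhs_ballP; exists (e `^ q^-1); first exact: powR_gt0.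
  by move=> y; rewrite /ball/= sub0r normrN.
have nx : 0 < `|x| by rewrite normr_gt0.
have c1 : {for `|x|, continuous (fun y : R => y `^ q)}.
  apply: differentiable_continuous; apply/derivable1_diffP.
  by have [] := is_derive1_powR q nx.
apply: (@continuous_comp _ _ _ (fun x : R => `|x|) (fun y : R => y `^ q)) => //.
exact: norm_continuous.
Unshelve. all: by end_near.
Qed.

Lemma continuous_signed_powR (hp : 2 < p) : continuous signed_powR.
Proof.
move=> x; apply: cvgM; last exact: cvg_id.
by apply: continuous_powR_norm; rewrite subr_gt0.
Qed.

End EdgeInequalities.

(** * Extremal problems for functions on a finite set *)
Section FiniteFunctions.
Context {R : realType} (T : finType).
Implicit Types (F H : {ffun T -> R} -> R) (g h : {ffun T -> R}).

(** Continuity for the product topology on T -> R, which is the one for which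
    Tychonoff's theorem gives compact boxes. *)
Definition coordwise_continuous F :=
  continuous (fun x : prod_topology (fun _ : T => R) => F (finfun x)).

Lemma coordwise_continuous_eval u : coordwise_continuous (fun g => g u).
Proof.
rewrite /coordwise_continuous.
have -> : (fun x : prod_topology (fun _ : T => R) => [ffun v => x v] u) =
    @proj T (fun=> R) u by apply/funext => x; rewrite ffunE.
exact: proj_continuous.
Qed.

Lemma coordwise_continuous_comp F (k : R -> R) :
  continuous k -> coordwise_continuous F -> coordwise_continuous (fun g => k (F g)).
Proof. by move=> kc Fc x; apply: continuous_comp (Fc x) (kc _). Qed.

Lemma coordwise_continuousM F H : coordwise_continuous F ->
  coordwise_continuous H -> coordwise_continuous (fun g => F g * H g).
Proof. by move=> Fc Hc x; exact: continuousM (Fc x) (Hc x). Qed.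

Lemma coordwise_continuousB F H : coordwise_continuous F ->
  coordwise_continuous H -> coordwise_continuous (fun g => F g - H g).
Proof. by move=> Fc Hc x; exact: continuousB (Fc x) (Hc x). Qed.

Lemma coordwise_continuousD F H : coordwise_continuous F ->
  coordwise_continuous H -> coordwise_continuous (fun g => F g + H g).
Proof. by move=> Fc Hc x; exact: continuousD (Fc x) (Hc x). Qed.

Lemma coordwise_continuous_cst (c : R) : coordwise_continuous (fun=> c).
Proof. by move=> x; exact: cst_continuous. Qed.

Lemma coordwise_continuous_sum (I : finType) (F : I -> {ffun T -> R} -> R) :
  (forall i, coordwise_continuous (F i)) ->
  coordwise_continuous (fun g => \sum_i F i g).
Proof.
move=> Fc; apply: continuous_big => [|i _]; last exact: Fc.
exact: add_continuous.
Qed.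

(** Existence of a maximizer under one equality constraint; the compact set is the
    intersection of a box with the closed zero set of H. *)
Lemma box_constrained_max (F H : {ffun T -> R} -> R) (r : R) g0 :
    coordwise_continuous F -> coordwise_continuous H ->
    (forall u, `|g0 u| <= r) -> H g0 = 0 ->
  exists g, H g = 0 /\
    forall h, (forall u, `|h u| <= r) -> H h = 0 -> F h <= F g.
Proof.
move=> Fc Hc g0r Hg0.
pose X : topologicalType := prod_topology (fun _ : T => R).
pose B : set X := [set x : T -> R | forall u, `[- r, r]%classic (x u)]%classic.
pose Z : set X := ((fun x : X => H (finfun x)) @^-1` [set 0])%classic.
have cB : compact B.
  apply: (@tychonoff T (fun=> R) (fun=> `[- r, r]%classic)) => u.
  exact: segment_compact.
have cBZ : compact (B `&` Z)%classic.
  apply: compact_closedI => //; apply: preimage_closed; last exact: closed_eq.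
  by move=> x _; exact: Hc.
have BP h : (forall u, `|h u| <= r) -> B (h : T -> R).
  by move=> hr u /=; rewrite in_itv /= -ler_norml.
have [||g] := @compact_EVT_max X R (fun x => F (finfun x)) (B `&` Z)%classic _ cBZ.
- by exists (g0 : T -> R); split; [exact: BP | rewrite /Z /= ffunK].
- by apply: continuous_subspaceT.
- rewrite inE => -[gB gZ] gmax; exists (finfun g); split => // h hr Hh.
  have := gmax (h : T -> R); rewrite ffunK inE; apply; split; first exact: BP.
  by rewrite /Z /= ffunK.
Qed.

End FiniteFunctions.

(** * Calculus on the graph *)
Section GraphCalculus.
Context {R : realType} (G : wgraph R).
Implicit Types (f g h : {ffun inode G -> R}) (phi : {ffun oedge G -> R}).
Implicit Types (u v : inode G) (e : oedge G) (x : vertex G).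

Definition indicator u : {ffun inode G -> R} := [ffun v => (v == u)%:R].

Lemma ext0_inode f u : ext0 f (val u) = f u.
Proof. by rewrite /ext0 valK. Qed.

Lemma ext0_boundary f x : x \in boundary G -> ext0 f x = 0.
Proof. by move=> xB; rewrite /ext0 insubN ?negbK. Qed.

Variant vertex_spec x : Prop :=
  | InternalVertex u of x = val u
  | BoundaryVertex of x \in boundary G.

Lemma vertexP x : vertex_spec x.
Proof.
have [xB|xI] := boolP (x \in boundary G); first exact: BoundaryVertex.
exact: (@InternalVertex _ (Sub x xI)).
Qed.

(** Writes the extension by zero as an explicit linear form; linearity and
    continuity of the gradient follow from it. *)
Lemma ext0_sum f x : ext0 f x = \sum_u f u * (val u == x)%:R.
Proof.
case: (vertexP x) => [u ->|xB].
  rewrite ext0_inode (bigD1 u)//= eqxx mulr1 big1 ?addr0// => v vu.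
  by rewrite (inj_eq val_inj) (negbTE vu) mulr0.
rewrite ext0_boundary// big1// => u _.
case: eqP => [ux|_]; last by rewrite mulr0.
by have := valP u; rewrite /= ux xB.
Qed.

Lemma gradE f e :
  grad f e = weight G (val e).1 (val e).2 * (ext0 f (val e).2 - ext0 f (val e).1).
Proof. by rewrite ffunE; case: (val e). Qed.

Lemma weight_oedge_gt0 e : 0 < weight G (val e).1 (val e).2.
Proof.
by case: e => -[x y] /= xy; apply: weight_gt0; rewrite orientedE xy.
Qed.

Lemma grad_sum f e : grad f e = \sum_u f u * grad (indicator u) e.
Proof.
rewrite gradE !ext0_sum -sumrB mulr_sumr; apply: eq_bigr => u _.
have E x : ext0 (indicator u) x = (val u == x)%:R.
  rewrite ext0_sum (bigD1 u)//= ffunE eqxx mul1r big1 ?addr0// => v vu.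
  by rewrite ffunE (negbTE vu) mul0r.
by rewrite gradE !E; ring.
Qed.

Lemma grad_lincomb a b f g e :
  grad [ffun u => a * f u + b * g u] e = a * grad f e + b * grad g e.
Proof.
rewrite !(grad_sum _ e) !mulr_sumr -big_split; apply: eq_bigr => u _ /=.
by rewrite !ffunE; ring.
Qed.

(** Summation by parts. *)
Lemma gradT_adjoint phi h :
  \sum_e phi e * grad h e = \sum_u gradT phi u * h u.
Proof.
under [RHS]eq_bigr do rewrite ffunE mulr_suml.
rewrite exchange_big; apply: eq_bigr => e _ /=.
by rewrite (grad_sum h) mulr_sumr; apply: eq_bigr => u _; rewrite /indicator; ring.
Qed.

Lemma coordwise_continuous_grad e : coordwise_continuous (fun g => grad g e).
Proof.
have -> : (fun g => grad g e) = (fun g => \sum_u g u * grad (indicator u) e).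
  by apply/funext => g; rewrite grad_sum.
apply: coordwise_continuous_sum => u; apply: coordwise_continuousM.
  exact: coordwise_continuous_eval.
exact: coordwise_continuous_cst.
Qed.

Hypothesis hconn : graph_connected G.

(** Each edge has one orientation in [oriented], so a property must pass through
    it both ways to follow every path. *)
Lemma connected_propagation (P : inode G -> Prop) :
  (forall u v, (val u, val v) \in oriented G -> (P u <-> P v)) ->
  forall u v, P u -> P v.
Proof.
move=> Pstep u v Pu; have [conn _] := hconn.
have /connectP[s] := conn _ _ (valP u) (valP v).
elim: s u Pu => [|x s IH] u Pu /=.
  by move=> _ /val_inj ->.
move=> /andP[/and3P[_ xI ux] xs] vE.
apply: (IH (Sub x xI)) => //.
move: ux; rewrite orientedE => /orP[] ux.
  by apply/(Pstep u (Sub x xI)).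
by apply/(Pstep (Sub x xI) u).
Qed.

Hypothesis hB : boundary G != finset.set0.

Lemma boundary_edge : exists u x, x \in boundary G /\
  ((val u, x) \in oriented G \/ (x, val u) \in oriented G).
Proof.
have [u [x [uI xB ux]]] := hconn.2 hB; exists (Sub u uI), x; split => //.
by move: ux; rewrite orientedE => /orP[]; [left|right].
Qed.

(** A function with zero gradient is constant on the internal nodes, and the edge to
    the boundary makes the constant zero. *)
Lemma grad_eq0 g : (forall e, grad g e = 0) -> g = 0.
Proof.
move=> g0.
have same x y : (x, y) \in oriented G -> ext0 g x = ext0 g y.
  move=> xy; have := g0 (Sub (x, y) xy); rewrite gradE/= => /eqP.
  have := weight_oedge_gt0 (Sub (x, y) xy); rewrite /= mulf_eq0 => /gt_eqF -> /=.
  by rewrite subr_eq0 => /eqP.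
have [u [x [xB ux]]] := boundary_edge.
have gu : g u = 0.
  rewrite -ext0_inode -(ext0_boundary g xB).
  by case: ux => [/same|/same/esym].
apply/ffunP => v; rewrite [RHS]ffunE.
apply: (connected_propagation (P := fun w => g w = 0)) gu => w w' /same.
by rewrite !ext0_inode => ->.
Qed.

(** As g >= 0, at a zero u of g every edge contributes a nonpositive amount to
    [plap p g u], while the equation makes the sum zero. So g vanishes at all neighbours of u,
    and by connectedness everywhere. *)
Lemma strong_maximum_principle p (k g : {ffun inode G -> R}) :
    2 < p -> (forall u, 0 <= g u) -> g != 0 ->
    plap p g = [ffun u => k u * g u] ->
  forall u, 0 < g u.
Proof.
move=> hp g0 gN0 gE u; rewrite lt_neqAle g0 andbT eq_sym.
apply/negP => /eqP gu0; case/eqP: gN0; apply/ffunP => v; rewrite [RHS]ffunE.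
have ext_ge0 x : 0 <= ext0 g x.
  by case: (vertexP x) => [w ->|xB]; rewrite ?ext0_inode ?ext0_boundary.
have sign_le w e : g w = 0 -> grad (indicator w) e * grad g e <= 0.
  move=> gw0; rewrite !gradE; set a := weight _ _ _.
  have a0 : 0 < a := weight_oedge_gt0 e.
  have -> : a * (ext0 (indicator w) (val e).2 - ext0 (indicator w) (val e).1) *
      (a * (ext0 g (val e).2 - ext0 g (val e).1)) = a ^+ 2 *
      ((ext0 (indicator w) (val e).2 - ext0 (indicator w) (val e).1) *
      (ext0 g (val e).2 - ext0 g (val e).1)) by ring.
  rewrite pmulr_rle0 ?exprn_gt0//.
  have E x : (ext0 (indicator w) x = 0) \/
      (ext0 (indicator w) x = 1 /\ ext0 g x = 0).
    case: (vertexP x) => [w' ->|xB]; last by rewrite !ext0_boundary//; left.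
    rewrite !ext0_inode ffunE; have [->|_] := eqVneq w' w; last by left.
    by right.
  have := ext_ge0 (val e).1; have := ext_ge0 (val e).2.
  by case: (E (val e).1) => [->|[-> ->]]; case: (E (val e).2) => [->|[-> ->]]; lra.
have term0 w e : g w = 0 -> grad (indicator w) e * grad g e = 0.
  move=> gw0.
  have /eqP : plap p g w = 0 by rewrite gE ffunE gw0 mulr0.
  rewrite ffunE.
  have -> : \sum_(e0 : oedge G) grad [ffun v0 => (v0 == w)%:R] e0 *
      [ffun e1 => `|grad g e1| `^ (p - 2) * grad g e1] e0 =
    - \sum_e0 - (grad (indicator w) e0 * grad g e0) * `|grad g e0| `^ (p - 2).
    rewrite -sumrN; apply: eq_bigr => e0 _; rewrite [in LHS]ffunE /indicator; ring.
  rewrite oppr_eq0 psumr_eq0; last first.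
    by move=> e0 _; rewrite mulr_ge0 ?powR_ge0// oppr_ge0 sign_le.
  move=> /allP/(_ e); rewrite mem_index_enum => /(_ erefl)/=.
  rewrite mulf_eq0 oppr_eq0 => /orP[/eqP->//|].
  by rewrite powR_eq0 normr_eq0 => /andP[/eqP -> _]; rewrite mulr0.
apply: (connected_propagation (P := fun w => g w = 0)) gu0 => w w' ww'.
set e : oedge G := Sub (val w, val w') ww'.
have a0 := weight_oedge_gt0 e.
have [ww|ww] := eqVneq w w'; first by rewrite ww.
have T1 := term0 w e; have T2 := term0 w' e.
rewrite !gradE !ext0_inode !ffunE !eqxx (eq_sym w') (negbTE ww) in T1 T2.
have aN0 : weight G (val w) (val w') != 0 := lt0r_neq0 a0.
split=> [/[dup]gw0/T1/eqP|/[dup]gw0/T2/eqP];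
  rewrite !mulf_eq0 (negbTE aN0) gw0/= ?subr0 ?sub0r ?oppr_eq0 ?oner_eq0 /=;
  by move=> /eqP.
Qed.

End GraphCalculus.

(** * The functionals and their homogeneity *)
Section Functionals.
Context {R : realType} (G : wgraph R) (p : R).
Implicit Types (f g h nu : {ffun inode G -> R}) (mu : {ffun oedge G -> R}).
Implicit Types (u v : inode G) (e : oedge G) (t s : R).

Definition dirichlet g := \sum_e `|grad g e| `^ p.
Definition mass g := \sum_u `|g u| `^ p.
Definition wdirichlet mu g := \sum_e mu e * `|grad g e| ^+ 2.
Definition wmass nu g := \sum_u nu u * `|g u| ^+ 2.

(** Its maximum over g is, up to the term in nu alone, the minimum over mu of the
    energy. *)
Definition gain nu g := 2 * Num.sqrt (wmass nu g) - 2 / p * dirichlet g.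

Lemma dirichlet_ge0 g : 0 <= dirichlet g.
Proof. by apply: sumr_ge0 => e _; exact: powR_ge0. Qed.

Lemma mass_ge0 g : 0 <= mass g.
Proof. by apply: sumr_ge0 => u _; exact: powR_ge0. Qed.

Lemma wmass_ge0 nu g : (forall u, 0 <= nu u) -> 0 <= wmass nu g.
Proof. by move=> nu0; apply: sumr_ge0 => u _; rewrite mulr_ge0 ?sqr_ge0. Qed.

Lemma wdirichlet_ge0 mu g : (forall e, 0 <= mu e) -> 0 <= wdirichlet mu g.
Proof. by move=> mu0; apply: sumr_ge0 => u _; rewrite mulr_ge0 ?sqr_ge0. Qed.

Lemma gradZ t g e : grad [ffun u => t * g u] e = t * grad g e.
Proof.
by rewrite !(grad_sum _ e) mulr_sumr; apply: eq_bigr => u _; rewrite ffunE mulrA.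
Qed.

Lemma dirichletZ t g : dirichlet [ffun u => t * g u] = `|t| `^ p * dirichlet g.
Proof.
rewrite mulr_sumr; apply: eq_bigr => e _.
by rewrite gradZ normrM powRM.
Qed.

Lemma massZ t g : mass [ffun u => t * g u] = `|t| `^ p * mass g.
Proof.
rewrite mulr_sumr; apply: eq_bigr => u _.
by rewrite ffunE normrM powRM.
Qed.

Lemma wmassZ t nu g : wmass nu [ffun u => t * g u] = t ^+ 2 * wmass nu g.
Proof.
rewrite mulr_sumr; apply: eq_bigr => u _.
by rewrite ffunE !real_normK ?num_real//; ring.
Qed.

Definition absf g : {ffun inode G -> R} := [ffun u => `|g u|].

(** ||a| - |b|| <= |a - b| on each edge. *)
Lemma dirichlet_absf_le g : 0 <= p -> dirichlet (absf g) <= dirichlet g.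
Proof.
move=> p0; apply: ler_sum => e _; apply: ge0_ler_powR; rewrite ?nnegrE//.
have E x : ext0 (absf g) x = `|ext0 g x|.
  case: (vertexP x) => [u ->|xB]; first by rewrite !ext0_inode ffunE.
  by rewrite !ext0_boundary// normr0.
rewrite !gradE !E !normrM ler_pM2l ?normr_gt0 ?lt0r_neq0 ?weight_oedge_gt0//.
exact: ler_dist_dist.
Qed.

Lemma mass_absf g : mass (absf g) = mass g.
Proof. by apply: eq_bigr => u _; rewrite ffunE normr_id. Qed.

Lemma wmass_absf nu g : wmass nu (absf g) = wmass nu g.
Proof. by apply: eq_bigr => u _; rewrite ffunE normr_id. Qed.

Lemma coordwise_continuous_dirichlet : 0 < p -> coordwise_continuous dirichlet.
Proof.
move=> p0; apply: coordwise_continuous_sum => e.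
apply: (coordwise_continuous_comp (continuous_powR_norm p0)).
exact: coordwise_continuous_grad.
Qed.

Lemma coordwise_continuous_mass : 0 < p -> coordwise_continuous mass.
Proof.
move=> p0; apply: coordwise_continuous_sum => u.
apply: (coordwise_continuous_comp (continuous_powR_norm p0)).
exact: coordwise_continuous_eval.
Qed.

Lemma coordwise_continuous_wmass nu : coordwise_continuous (wmass nu).
Proof.
rewrite (_ : wmass nu = fun g => \sum_u nu u * (g u * g u)); last first.
  by apply/funext => g; apply: eq_bigr => u _; rewrite real_normK ?num_real.
apply: coordwise_continuous_sum => u.
apply: coordwise_continuousM; first exact: coordwise_continuous_cst.
by apply: coordwise_continuousM; exact: coordwise_continuous_eval.
Qed.

Lemma normr_powR_le_mass g u : `|g u| `^ p <= mass g.
Proof.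
rewrite /mass (bigD1 u)//= lerDl; apply: sumr_ge0 => v _; exact: powR_ge0.
Qed.

Lemma mass0 : p != 0 -> mass 0 = 0.
Proof. by move=> p0; apply: big1 => u _; rewrite ffunE normr0 powR0. Qed.

Lemma mass_eq0 g : mass g = 0 -> g = 0.
Proof.
move=> g0; apply/ffunP => u; rewrite [RHS]ffunE; apply/eqP; rewrite -normr_eq0.
apply/eqP; apply: (@powR_eq0_eq0 _ _ p).
by apply/eqP; rewrite eq_le powR_ge0 -g0 normr_powR_le_mass.
Qed.

Lemma mass_gt0 g : g != 0 -> 0 < mass g.
Proof.
move=> g0; rewrite lt_neqAle mass_ge0 andbT eq_sym.
by apply: contra g0 => /eqP/mass_eq0 ->.
Qed.

Lemma dirichlet_gt0 g : graph_connected G -> boundary G != finset.set0 ->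
  g != 0 -> 0 < dirichlet g.
Proof.
move=> hconn hB g0; rewrite lt_neqAle dirichlet_ge0 andbT eq_sym.
apply: contra g0 => /eqP D0; apply/eqP/(grad_eq0 hconn hB) => e.
apply/eqP; rewrite -normr_eq0; apply/eqP; apply: (@powR_eq0_eq0 _ _ p).
apply/eqP; rewrite eq_le powR_ge0 andbT -D0 /dirichlet (bigD1 e)//= lerDl.
by apply: sumr_ge0 => e' _; exact: powR_ge0.
Qed.

Lemma plap_adjoint g h :
  \sum_e signed_powR p (grad g e) * grad h e = \sum_u plap p g u * h u.
Proof.
by rewrite /plap -gradT_adjoint; apply: eq_bigr => e _; rewrite [in RHS]ffunE.
Qed.

Lemma plap_mulr_sum (hp : 2 < p) g : \sum_u plap p g u * g u = dirichlet g.
Proof.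
by rewrite -plap_adjoint; apply: eq_bigr => e _; rewrite signed_powR_mulr.
Qed.

Lemma plapE g u :
  plap p g u = \sum_e grad (indicator u) e * signed_powR p (grad g e).
Proof. by rewrite ffunE; apply: eq_bigr => e _; congr (_ * _); rewrite ffunE. Qed.

End Functionals.

(** * Existence of a minimizer of the p-Rayleigh quotient *)
Section FirstEigenfunction.
Context {R : realType} (G : wgraph R) (p : R).
Hypotheses (hconn : graph_connected G) (hB : boundary G != finset.set0).
Implicit Types (f g h nu : {ffun inode G -> R}).

Lemma dirichlet_minimizer (hp : 2 < p) : exists f : {ffun inode G -> R},
  [/\ forall u, 0 <= f u, mass p f = 1 &
      forall g, dirichlet p f * mass p g <= dirichlet p g].
Proof.
have p0 : 0 < p by lra.
have [u0 _] := boundary_edge hconn hB.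
have m1 : mass p (indicator u0) = 1.
  rewrite /mass (bigD1 u0)//= ffunE eqxx normr1 powR1 big1 ?addr0// => v vu.
  by rewrite ffunE (negbTE vu) normr0 powR0// gt_eqF.
have Fc : coordwise_continuous (fun g : {ffun inode G -> R} => 0 - dirichlet p g).
  apply: coordwise_continuousB; first exact: coordwise_continuous_cst.
  exact: coordwise_continuous_dirichlet.
have Hc : coordwise_continuous (fun g : {ffun inode G -> R} => mass p g - 1).
  apply: coordwise_continuousB; last exact: coordwise_continuous_cst.
  exact: coordwise_continuous_mass.
have [||f [f1 fmax]] := @box_constrained_max _ _ _ _ 1 (indicator u0) Fc Hc.
- by move=> v; rewrite ffunE; case: eqP; rewrite ?normr1 ?normr0.
- by rewrite m1 subrr.
have {}f1 : mass p f = 1 by apply/eqP; rewrite -subr_eq0 f1.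
have fmin g : mass p g = 1 -> dirichlet p f <= dirichlet p g.
  move=> g1; have := fmax g; rewrite g1 subrr !sub0r lerN2; apply => // u.
  have := normr_powR_le_mass p g u; rewrite g1 => gu.
  rewrite leNgt; apply/negP => gu1; have := gt0_ltr_powR p0 _ _ gu1.
  by rewrite powR1 !nnegrE ltNge gu => /(_ ler01 (normr_ge0 _)).
exists (absf f); split => [u||g]; first by rewrite ffunE.
  by rewrite mass_absf.
apply: le_trans (_ : dirichlet p f * mass p g <= _).
  by apply: ler_wpM2r; [exact: mass_ge0 | apply: dirichlet_absf_le; exact: ltW].
have [->|g0] := eqVneq g 0.
  by rewrite mass0 ?gt_eqF// mulr0 dirichlet_ge0.
have m0 := mass_gt0 p g0.
have tE : `|mass p g `^ (- p^-1)| `^ p = (mass p g)^-1.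
  rewrite ger0_norm ?powR_ge0// -powRrM mulNr mulVf ?gt_eqF//.
  by rewrite powR_inv1// ltW.
have := fmin [ffun u => mass p g `^ (- p^-1) * g u].
rewrite massZ dirichletZ tE mulVf ?gt_eqF// => /(_ erefl).
by rewrite -ler_pdivlMr// mulrC.
Qed.

End FirstEigenfunction.

(** * Bounds on the first weighted eigenvalue *)
Section WeightedEigenvalue.
Context {R : realType} (G : wgraph R).
Implicit Types (f g h nu : {ffun inode G -> R}) (mu : {ffun oedge G -> R}).
Implicit Types (u v : inode G) (e : oedge G).

Lemma lap_muE mu g u :
  lap_mu mu g u = \sum_e grad (indicator u) e * (mu e * grad g e).
Proof. by rewrite ffunE; apply: eq_bigr => e _; congr (_ * _); rewrite ffunE. Qed.

Lemma lap_mu_adjoint mu g h :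
  \sum_e mu e * grad g e * grad h e = \sum_u lap_mu mu g u * h u.
Proof.
by rewrite /lap_mu -gradT_adjoint; apply: eq_bigr => e _; rewrite [in RHS]ffunE.
Qed.

Lemma lap_mu_lincomb mu a b g h u :
  lap_mu mu [ffun v => a * g v + b * h v] u = a * lap_mu mu g u + b * lap_mu mu h u.
Proof.
rewrite !lap_muE !mulr_sumr -big_split; apply: eq_bigr => e _ /=.
by rewrite grad_lincomb; ring.
Qed.

Lemma coordwise_continuous_lap_mu mu u :
  coordwise_continuous (fun g => lap_mu mu g u).
Proof.
rewrite (_ : (fun g => lap_mu mu g u) =
  fun g => \sum_e grad (indicator u) e * (mu e * grad g e)); last first.
  by apply/funext => g; rewrite lap_muE.
apply: coordwise_continuous_sum => e.
do 2 (apply: coordwise_continuousM; first exact: coordwise_continuous_cst).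
exact: coordwise_continuous_grad.
Qed.

Lemma wdirichlet_lap mu g : wdirichlet mu g = \sum_u lap_mu mu g u * g u.
Proof.
rewrite -lap_mu_adjoint; apply: eq_bigr => e _.
by rewrite real_normK ?num_real// expr2 mulrA.
Qed.

(** The first eigenvalue only tests functions orthogonal to the common kernel, so
    an arbitrary g must be projected. The projection is the element of least
    Euclidean norm with the same images as g under diag(nu) and Delta_mu; both
    quadratic forms depend on these images only. *)
Lemma ker_perp_projection mu nu g : exists g',
  [/\ ker_perp mu nu g', wmass nu g' = wmass nu g &
      wdirichlet mu g' = wdirichlet mu g].
Proof.
pose n2 x : R := \sum_(u : inode G) x u * x u.
pose d1 x u := diag_nu nu x u - diag_nu nu g u.
pose d2 x u := lap_mu mu x u - lap_mu mu g u.
pose H x := \sum_u (d1 x u * d1 x u + d2 x u * d2 x u).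
have HP x : H x = 0 <-> diag_nu nu x = diag_nu nu g /\ lap_mu mu x = lap_mu mu g.
  split=> [/eqP|[E1 E2]]; last first.
    by apply: big1 => u _; rewrite /d1 /d2 E1 E2 !subrr !mulr0 addr0.
  rewrite psumr_eq0 => [/allP H0|u _]; last by rewrite addr_ge0// -expr2 sqr_ge0.
  have {}H0 u : d1 x u = 0 /\ d2 x u = 0.
    have := H0 u; rewrite mem_index_enum => /(_ erefl)/=.
    by rewrite paddr_eq0 -?expr2 ?sqr_ge0// !sqrf_eq0 => /andP[/eqP-> /eqP->].
  by split; apply/ffunP => u; apply/eqP; rewrite -subr_eq0;
    apply/eqP; have [] := H0 u.
have n2_ge0 x : 0 <= n2 x by apply: sumr_ge0 => u _; rewrite -expr2 sqr_ge0.
have n2_coord x u : `|x u| <= Num.sqrt (n2 x).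
  rewrite -(ger0_norm (sqrtr_ge0 _)) -ler_sqr ?nnegrE// !real_normK ?num_real//.
  rewrite sqr_sqrtr// /n2 (bigD1 u)//= -expr2 lerDl.
  by apply: sumr_ge0 => v _; rewrite -expr2 sqr_ge0.
have Fc : coordwise_continuous (fun x => 0 - n2 x).
  apply: coordwise_continuousB; first exact: coordwise_continuous_cst.
  apply: coordwise_continuous_sum => u.
  by apply: coordwise_continuousM; exact: coordwise_continuous_eval.
have Hc : coordwise_continuous H.
  apply: coordwise_continuous_sum => u.
  have c1 : coordwise_continuous (fun x => d1 x u).
    apply: coordwise_continuousB; last exact: coordwise_continuous_cst.
    rewrite (_ : (fun x => diag_nu nu x u) = fun x => nu u * x u); last first.
      by apply/funext => x; rewrite ffunE.
    apply: coordwise_continuousM; first exact: coordwise_continuous_cst.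
    exact: coordwise_continuous_eval.
  have c2 : coordwise_continuous (fun x => d2 x u).
    apply: coordwise_continuousB; last exact: coordwise_continuous_cst.
    exact: coordwise_continuous_lap_mu.
  by apply: coordwise_continuousD; apply: coordwise_continuousM.
have Hg : H g = 0 by apply/HP.
have [g' [/HP[E1 E2] g'max]] := box_constrained_max Fc Hc (n2_coord g) Hg.
have g'min x : H x = 0 -> n2 g' <= n2 x.
  move=> Hx; have [xg|gx] := leP (n2 x) (n2 g); last first.
    apply: le_trans (ltW gx).
    by have := g'max g (n2_coord g) Hg; rewrite !sub0r lerN2.
  have := g'max x; rewrite !sub0r lerN2; apply => // u.
  exact: le_trans (n2_coord x u) (ler_wsqrtr xg).
exists g'; split.
- move=> h h1 h2; set S := \sum_u _.
  (* The 1 keeps the denominator nonzero, with h = 0 included. *)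
  pose t := - S / (n2 h + 1).
  have m0 : 0 < n2 h + 1 by rewrite ltr_wpDl.
  have := g'min [ffun u => 1 * g' u + t * h u].
  have -> : n2 [ffun u => 1 * g' u + t * h u] = n2 g' + 2 * t * S + t ^+ 2 * n2 h.
    rewrite /n2 /S !mulr_sumr -!big_split; apply: eq_bigr => u _ /=.
    by rewrite !ffunE; ring.
  have -> : H [ffun u => 1 * g' u + t * h u] = 0.
    apply/HP; rewrite -E1 -E2; split; apply/ffunP => u.
      have := congr1 (fun f => f u) h1; rewrite !ffunE => hu.
      by rewrite mulrDr mulrCA [nu u * (t * _)]mulrCA hu mulr0 addr0 mul1r.
    by rewrite lap_mu_lincomb h2 [X in _ + _ * X]ffunE mulr0 addr0 mul1r.
  move=> /(_ erefl); rewrite -addrA lerDl.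
  have -> : 2 * t * S + t ^+ 2 * n2 h = - (S / (n2 h + 1)) ^+ 2 * (n2 h + 2).
    by rewrite /t; field; rewrite gt_eqF.
  rewrite mulNr oppr_ge0 pmulr_lle0; last by rewrite ltr_wpDl.
  move=> le0; have : S / (n2 h + 1) == 0 by rewrite -sqrf_eq0 eq_le le0 sqr_ge0.
  by rewrite mulf_eq0 invr_eq0 (gt_eqF m0) orbF => /eqP.
- apply: eq_bigr => u _; rewrite !real_normK ?num_real// !expr2.
  have := congr1 (fun f => f u) E1; rewrite !ffunE => Eu.
  by rewrite mulrA Eu -mulrA mulrCA Eu mulrCA.
- rewrite !wdirichlet_lap E2 -lap_mu_adjoint -E2 -[RHS]lap_mu_adjoint.
  by apply: eq_bigr => e _; ring.
Qed.

Lemma rayleigh2_ge0 mu nu g : (forall e, 0 <= mu e) -> (forall u, 0 <= nu u) ->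
  (0%:E <= rayleigh2 mu nu g)%E.
Proof.
move=> mu0 nu0; rewrite /rayleigh2; case: ifP => _; first by rewrite leey.
by rewrite lee_fin divr_ge0 ?wdirichlet_ge0 ?wmass_ge0.
Qed.

Lemma lambda1_ge0 mu nu : (forall e, 0 <= mu e) -> (forall u, 0 <= nu u) ->
  (0%:E <= lambda1 mu nu)%E.
Proof.
by move=> mu0 nu0; apply: le_ereal_inf_tmp => _ [g _ <-]; exact: rayleigh2_ge0.
Qed.

(** 1 / lambda >= N / T >= 2 sqrt(N) - T. In the second form the bound also makes
    sense when N or T vanishes. *)
Lemma inv_lambda1_ge mu nu g : (forall e, 0 <= mu e) -> (forall u, 0 <= nu u) ->
  ((2 * Num.sqrt (wmass nu g) - wdirichlet mu g)%:E <= (lambda1 mu nu)^-1)%E.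
Proof.
move=> mu0 nu0; have l0 := lambda1_ge0 mu0 nu0.
have T0 := wdirichlet_ge0 g mu0; have N0 := wmass_ge0 g nu0.
have [N|N] := eqVneq (wmass nu g) 0.
  rewrite N sqrtr0 mulr0 sub0r; apply: (@le_trans _ _ 0%:E).
    by rewrite lee_fin oppr_le0.
  by rewrite inve_ge0.
have {}N0 : 0 < wmass nu g by rewrite lt_neqAle eq_sym N.
have [g' [g'perp g'N g'T]] := ker_perp_projection mu nu g.
have : (lambda1 mu nu <= (wdirichlet mu g / wmass nu g)%:E)%E.
  apply: ereal_inf_lbound; exists g'.
    split => //; apply: contra N => /eqP g'0; rewrite -g'N g'0; apply/eqP.
    by apply: big1 => u _; rewrite ffunE normr0 expr0n mulr0.
  by rewrite /rayleigh2 -!/(wmass _ _) -!/(wdirichlet _ _) g'N g'T (negbTE N).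
move: l0; case: (lambda1 mu nu) => [x|//|//]; rewrite !lee_fin => x0 xTN.
rewrite inver; case: eqVneq => [_|xN0]; first by rewrite leey.
have {}x0 : 0 < x by rewrite lt_neqAle eq_sym xN0.
rewrite lee_fin.
have T1 : 0 < wdirichlet mu g.
  by have := lt_le_trans x0 xTN; rewrite pmulr_lgt0// invr_gt0.
apply: (@le_trans _ _ (wmass nu g / wdirichlet mu g)); last first.
  by rewrite -[leLHS]invrK invf_div lef_pV2 ?posrE ?divr_gt0.
rewrite ler_pdivlMr// -[leRHS]sqr_sqrtr ?(ltW N0)// -subr_ge0.
set s := Num.sqrt _; set T := wdirichlet _ _.
by rewrite (_ : _ - _ = (s - T) ^+ 2) ?sqr_ge0//; ring.
Qed.

Lemma inv_lambda1_le mu nu k : 0 < k -> (forall u, 0 <= nu u) ->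
  (forall h, wmass nu h <= k * wdirichlet mu h) ->
  ((lambda1 mu nu)^-1 <= k%:E)%E.
Proof.
move=> k0 nu0 hk.
have : (k^-1%:E <= lambda1 mu nu)%E.
  apply: le_ereal_inf_tmp => _ [h _ <-]; rewrite /rayleigh2.
  rewrite -!/(wmass _ _) -!/(wdirichlet _ _).
  case: eqVneq => [_|N]; first by rewrite leey.
  have N0 : 0 < wmass nu h by rewrite lt_neqAle eq_sym N wmass_ge0.
  by rewrite lee_fin ler_pdivlMr// ler_pdivrMl.
case: (lambda1 mu nu) => [x|_|//]; last by rewrite invey lee_fin ltW.
rewrite lee_fin => kx; have x0 : 0 < x by rewrite (lt_le_trans _ kx)// invr_gt0.
by rewrite inver gt_eqF// lee_fin -[leRHS]invrK lef_pV2 ?posrE ?invr_gt0.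
Qed.

End WeightedEigenvalue.

(** * Maximizers of the gain and positive eigenfunctions *)
Section CriticalPoints.
Context {R : realType} (G : wgraph R) (p : R).
Implicit Types (f g h nu : {ffun inode G -> R}) (mu : {ffun oedge G -> R}).
Implicit Types (u v : inode G) (e : oedge G) (x : vertex G) (t s k : R).

(** Quotients such as h^2 / g commute with the extension by zero because
    0 / 0 = 0. *)
Lemma ext0_map2 (F : R -> R -> R) g h x : F 0 0 = 0 ->
  ext0 [ffun u => F (g u) (h u)] x = F (ext0 g x) (ext0 h x).
Proof.
move=> F0; case: (vertexP x) => [u ->|xB]; first by rewrite !ext0_inode ffunE.
by rewrite !ext0_boundary.
Qed.

Lemma wmass_cauchy_schwarz nu g h : (forall u, 0 <= nu u) -> 0 < wmass nu g ->
  \sum_u nu u * (g u * h u) <= Num.sqrt (wmass nu g) * Num.sqrt (wmass nu h).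
Proof.
move=> nu0 N0; set S := \sum_u _.
pose t := S / wmass nu g.
have := wmass_ge0 [ffun u => h u - t * g u] nu0.
have -> : wmass nu [ffun u => h u - t * g u] =
    wmass nu h - 2 * t * S + t ^+ 2 * wmass nu g.
  rewrite /wmass /S !mulr_sumr -sumrN -!big_split; apply: eq_bigr => u _ /=.
  by rewrite !ffunE !real_normK ?num_real//; ring.
have -> : wmass nu h - 2 * t * S + t ^+ 2 * wmass nu g =
    wmass nu h - S ^+ 2 / wmass nu g by rewrite /t; field; rewrite gt_eqF.
rewrite subr_ge0 ler_pdivrMr// => SN.
rewrite -sqrtrM ?(ltW N0)// (le_trans (ler_norm S))// -sqrtr_sqr.
by apply: ler_wsqrtr; rewrite mulrC.
Qed.

(** By Cauchy-Schwarz, sqrt(N(x)) is at least the linear form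
    x |-> (sum nu g x) / sqrt(N(g)), with equality at g. So g also maximizes a
    linear form minus a convex function. Comparing g with g + t h for t > 0 and
    using the tangent of |.|^p at the latter point gives the bound with the
    gradient of g + t h, and t tends to 0. *)
Let directional_derivative_ge (hp : 2 < p) nu g h : (forall u, 0 <= nu u) ->
    0 < wmass nu g -> (forall h, gain p nu h <= gain p nu g) ->
  (\sum_u nu u * (g u * h u)) / Num.sqrt (wmass nu g) <=
    \sum_e signed_powR p (grad g e) * grad h e.
Proof.
move=> nu0 N0 gmax; set S := \sum_u _; set k := Num.sqrt _.
have p0 : 0 < p by lra.
have k0 : 0 < k by rewrite sqrtr_gt0.
pose Q t := \sum_e signed_powR p (grad g e + t * grad h e) * grad h e.
have Qge t : 0 < t -> S / k <= Q t.
  move=> t0; pose x : {ffun inode G -> R} := [ffun u => 1 * g u + t * h u].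
  have xE e : grad x e = grad g e + t * grad h e by rewrite grad_lincomb mul1r.
  have CS := @wmass_cauchy_schwarz nu g x nu0 N0.
  have SE : \sum_u nu u * (g u * x u) = k ^+ 2 + t * S.
    rewrite sqr_sqrtr ?(ltW N0)// /wmass /S mulr_sumr -big_split.
    by apply: eq_bigr => u _ /=; rewrite ffunE real_normK ?num_real//; ring.
  rewrite SE -/k in CS.
  have D : dirichlet p x <= dirichlet p g + p * (t * Q t).
    rewrite /dirichlet /Q !mulr_sumr -big_split; apply: ler_sum => e _ /=.
    have := powR_norm_tangent hp (grad g e) (grad x e).
    rewrite xE; have -> : grad g e + t * grad h e - grad g e = t * grad h e by ring.
    by rewrite [signed_powR _ _ * _]mulrCA.
  have := gmax x; rewrite /gain -/k => Gx.
  have D2 : 2 / p * dirichlet p x <= 2 / p * dirichlet p g + 2 * (t * Q t).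
    have -> : 2 / p * dirichlet p g + 2 * (t * Q t) =
      2 / p * (dirichlet p g + p * (t * Q t)) by field; rewrite gt_eqF.
    by rewrite ler_pM2l// divr_gt0.
  have {}CS : k + t * (S / k) <= Num.sqrt (wmass nu x).
    rewrite -(ler_pM2l k0); apply: le_trans CS; rewrite le_eqVlt; apply/orP; left.
    by apply/eqP; field; rewrite gt_eqF.
  by rewrite -(ler_pM2l t0); lra.
have Qcont : continuous Q.
  apply: continuous_big => [|e _]; first exact: add_continuous.
  move=> t; apply: cvgM; last exact: cvg_cst.
  apply: (@continuous_comp _ _ _ (fun t => grad g e + t * grad h e)).
    apply: cvgD; first exact: cvg_cst.
    by apply: cvgM; [exact: cvg_id|exact: cvg_cst].
  exact: continuous_signed_powR.
have Q0 : Q 0 = \sum_e signed_powR p (grad g e) * grad h e.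
  by apply: eq_bigr => e _; rewrite mul0r addr0.
rewrite -Q0 leNgt; apply/negP => Qlt.
have /cvgrPdist_lt := Qcont 0.
move=> /(_ (S / k - Q 0)); rewrite subr_gt0 => /(_ Qlt) /nbhs_ballP[d /= d0 dQ].
have d20 : 0 < d / 2 by rewrite divr_gt0.
have := dQ (d / 2); rewrite /ball /= sub0r normrN gtr0_norm// => dQ2.
have {}dQ2 : `|Q 0 - Q (d / 2)| < S / k - Q 0.
  by apply: dQ2; rewrite ltr_pdivrMr// ltr_pMr// ltr1n.
by have := Qge _ d20; move: dQ2; rewrite ltr_norml => /andP[]; lra.
Qed.

(** Variations in the directions of an indicator and of its opposite. *)
Lemma gain_euler_lagrange (hp : 2 < p) nu g : (forall u, 0 <= nu u) ->
    0 < wmass nu g -> (forall h, gain p nu h <= gain p nu g) ->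
  forall u, plap p g u = nu u / Num.sqrt (wmass nu g) * g u.
Proof.
move=> nu0 N0 gmax u.
have step c : c * (nu u / Num.sqrt (wmass nu g) * g u) <= c * plap p g u.
  have := directional_derivative_ge hp [ffun v => c * indicator u v] nu0 N0 gmax.
  under eq_bigr do rewrite ffunE.
  under [X in _ <= X]eq_bigr do rewrite gradZ mulrCA.
  rewrite -mulr_sumr plapE; under [X in _ <= _ * X]eq_bigr do rewrite mulrC.
  rewrite (bigD1 u)//= ffunE eqxx big1 => [|v vu].
    by rewrite addr0 mulr1; apply: le_trans; rewrite le_eqVlt; apply/orP; left;
      apply/eqP; ring.
  by rewrite ffunE (negbTE vu) !mulr0.
by have := step 1; have := step (-1); lra.
Qed.

Definition edge_weight g : {ffun oedge G -> R} :=
  [ffun e => `|grad g e| `^ (p - 2)].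

Lemma edge_weight_ge0 g e : 0 <= edge_weight g e.
Proof. by rewrite ffunE powR_ge0. Qed.

Lemma lap_edge_weight g : lap_mu (edge_weight g) g = plap p g.
Proof.
apply/ffunP => u; rewrite lap_muE plapE; apply: eq_bigr => e _.
by rewrite [edge_weight g e]ffunE.
Qed.

Lemma wdirichlet_edge_weight (hp : 2 < p) g :
  wdirichlet (edge_weight g) g = dirichlet p g.
Proof. by rewrite wdirichlet_lap lap_edge_weight plap_mulr_sum. Qed.

(** Test the equation of g against h^2 / g: Picone's inequality bounds
    grad g . grad (h^2 / g) by |grad h|^2 on each edge. *)
Lemma ground_state_inequality (hp : 2 < p) nu g k : 0 < k -> (forall u, 0 < g u) ->
    (forall u, plap p g u = nu u / k * g u) ->
  forall h, wmass nu h <= k * wdirichlet (edge_weight g) h.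
Proof.
move=> k0 g0 gE h.
pose w : {ffun inode G -> R} := [ffun u => (fun a b => a ^+ 2 / b) (h u) (g u)].
have -> : wmass nu h = k * \sum_e signed_powR p (grad g e) * grad w e.
  rewrite plap_adjoint mulr_sumr; apply: eq_bigr => u _.
  rewrite gE /w ffunE real_normK ?num_real//.
  by field; rewrite !lt0r_neq0.
rewrite ler_pM2l//; apply: ler_sum => e _.
rewrite /signed_powR [edge_weight g e]ffunE -mulrA.
apply: ler_wpM2l; first exact: powR_ge0.
rewrite real_normK ?num_real// !gradE.
rewrite !(@ext0_map2 (fun a b => a ^+ 2 / b)) ?invr0 ?mulr0//.
set W := weight _ _ _; set b1 := ext0 g _; set b2 := ext0 g _.
set a1 := ext0 h _; set a2 := ext0 h _.
have -> : W * (b1 - b2) * (W * (a1 ^+ 2 / b1 - a2 ^+ 2 / b2)) =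
  W ^+ 2 * ((b1 - b2) * (a1 ^+ 2 / b1 - a2 ^+ 2 / b2)) by ring.
rewrite exprMn ler_wpM2l ?sqr_ge0//.
have pos x : (0 < ext0 g x) \/ (ext0 h x = 0 /\ ext0 g x = 0).
  case: (vertexP x) => [u ->|xB]; [left|right]; rewrite ?ext0_inode//.
  by rewrite !ext0_boundary.
rewrite /a1 /a2 /b1 /b2.
case: (pos (val e).1) => [q1|[-> ->]]; case: (pos (val e).2) => [q2|[-> ->]].
- exact: picone_square.
- by rewrite !sub0r expr0n mul0r sub0r mulrNN sqrrN mulrC divfK// gt_eqF.
- by rewrite !subr0 expr0n mul0r subr0 mulrC divfK// gt_eqF.
- by rewrite !subr0 mul0r expr0n.
Qed.

(** Test the equation of f against |g|^p / f^(p-1): the sum over the edges of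
    Picone's inequality is then an equality, so each edge gives an equality, and
    g / f takes the same value at both ends of each internal edge. *)
Lemma ground_state_unique (hp : 2 < p) l f g : graph_connected G ->
    (forall u, 0 < f u) -> (forall u, plap p f u = l * f u `^ (p - 1)) ->
    dirichlet p g <= l * mass p g ->
  exists c : R, forall u, g u = c * f u.
Proof.
move=> hconn f0 fE gmin; have p0 : 0 < p by lra.
have p1 : p - 1 != 0 by rewrite gt_eqF//; lra.
pose F (a b : R) := `|a| `^ p / b `^ (p - 1).
pose w : {ffun inode G -> R} := [ffun u => F (g u) (f u)].
have F00 : F 0 0 = 0 by rewrite /F (powR0 p1) invr0 mulr0.
have FE a b : 0 < b -> signed_powR p b * F a b = `|a| `^ p.
  move=> b0; rewrite (signed_powR_ge0 hp) ?(ltW b0)// /F mulrC divfK//.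
  by rewrite gt_eqF// powR_gt0.
have pos x : (0 < ext0 f x) \/ (ext0 g x = 0 /\ ext0 f x = 0).
  case: (vertexP x) => [u ->|xB]; [left|right]; rewrite ?ext0_inode//.
  by rewrite !ext0_boundary.
have scale e : exists2 c, 0 < c &
    signed_powR p (grad f e) * grad w e = c * (signed_powR p
      (ext0 f (val e).2 - ext0 f (val e).1) *
      (F (ext0 g (val e).2) (ext0 f (val e).2) -
       F (ext0 g (val e).1) (ext0 f (val e).1))) /\
    `|grad g e| `^ p = c * `|ext0 g (val e).2 - ext0 g (val e).1| `^ p.
  have W0 := weight_oedge_gt0 e; exists (weight G (val e).1 (val e).2 `^ p).
    exact: powR_gt0.
  rewrite !gradE !(ext0_map2 _ _ _ F00) (signed_powRM hp) ?(ltW W0)//.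
  rewrite normrM powRM// (gtr0_norm W0); split => //.
  by rewrite -(mulr_powRB1 (ltW W0) p0); ring.
have edge_le e : signed_powR p (grad f e) * grad w e <= `|grad g e| `^ p.
  have [c c0 [-> ->]] := scale e; rewrite ler_pM2l//.
  case: (pos (val e).1) => [q1|[-> ->]]; case: (pos (val e).2) => [q2|[-> ->]].
  - exact: picone_powR_le.
  - by rewrite F00 !sub0r signed_powRN mulrNN FE// normrN.
  - by rewrite F00 !subr0 FE.
  - by rewrite F00 !subr0 mulr0 powR_ge0.
have sumE : \sum_e signed_powR p (grad f e) * grad w e = l * mass p g.
  rewrite plap_adjoint mulr_sumr; apply: eq_bigr => u _.
  by rewrite fE ffunE -mulrA -(signed_powR_ge0 hp) ?FE// ltW.
have edge_eq e : `|grad g e| `^ p <= signed_powR p (grad f e) * grad w e.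
  have : \sum_e (`|grad g e| `^ p - signed_powR p (grad f e) * grad w e) <= 0.
    by rewrite sumrB sumE subr_le0.
  move=> /(le_trans _) H; rewrite -subr_le0; apply: H.
  rewrite (bigD1 e)//= lerDl; apply: sumr_ge0 => e' _.
  by rewrite subr_ge0.
have ratio u v : (val u, val v) \in oriented G -> g u / f u = g v / f v.
  move=> uv; pose e : oedge G := Sub (val u, val v) uv.
  have := edge_eq e; have [c c0 [-> ->]] := scale e; rewrite ler_pM2l// !ext0_inode.
  by move=> /(picone_powR_eq hp (f0 _) (f0 _)).
have [u0|none] := pickP (@predT (inode G)); last first.
  by exists 0 => u; have := none u.
move=> _; exists (g u0 / f u0) => u.
suff <- : g u / f u = g u0 / f u0 by rewrite divfK// gt_eqF.
apply: (connected_propagation hconn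
  (P := fun v => g v / f v = g u0 / f u0)) (erefl _).
by move=> v v' /ratio ->.
Qed.

End CriticalPoints.

(** * The energy and the gain *)
Section Energy.
Context {R : realType} (G : wgraph R) (p : R).
Implicit Types (f g h nu : {ffun inode G -> R}) (mu : {ffun oedge G -> R}).
Implicit Types (u v : inode G) (e : oedge G) (s l k : R).

Let sqr_powR_half (a : R) (q : R) : (`|a| ^+ 2) `^ (q / 2) = `|a| `^ q.
Proof.
rewrite -powR_mulrn// -powRrM; congr (_ `^ _).
by rewrite mulrC divfK.
Qed.

Lemma young_sum_le (hp : 2 < p) (T : finType) (m a : T -> R) :
  (forall i, 0 <= m i) ->
  \sum_i m i * `|a i| ^+ 2 <= (p - 2) / p * (\sum_i m i `^ (p / (p - 2))) +
                              2 / p * (\sum_i `|a i| `^ p).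
Proof.
move=> m0; rewrite !mulr_sumr -big_split; apply: ler_sum => i _ /=.
by rewrite -(sqr_powR_half (a i) p) young_half_le// sqr_ge0.
Qed.

Lemma young_sum_eq (hp : 2 < p) (T : finType) (m a : T -> R) :
  (forall i, 0 <= m i) ->
  (p - 2) / p * (\sum_i m i `^ (p / (p - 2))) + 2 / p * (\sum_i `|a i| `^ p) <=
    \sum_i m i * `|a i| ^+ 2 ->
  forall i, m i = `|a i| `^ (p - 2).
Proof.
move=> m0 H i; rewrite -sqr_powR_half; apply: young_half_eq; rewrite ?sqr_ge0//.
rewrite sqr_powR_half; set yi := leLHS.
have : \sum_i ((p - 2) / p * m i `^ (p / (p - 2)) + 2 / p * `|a i| `^ p -
               m i * `|a i| ^+ 2) <= 0.
  by rewrite sumrB big_split -!mulr_sumr subr_le0.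
move=> /(le_trans _) H0; rewrite -subr_le0; apply: H0.
rewrite (bigD1 i)//= lerDl; apply: sumr_ge0 => j _.
by rewrite subr_ge0 -(sqr_powR_half (a j) p) young_half_le// sqr_ge0.
Qed.

Let two_sqrt_le s (N : R) : 0 < s -> 0 <= N -> 2 * Num.sqrt N <= s^-1 + s * N.
Proof.
move=> s0 N0; rewrite -subr_ge0.
have -> : s^-1 + s * N - 2 * Num.sqrt N = s * (Num.sqrt N - s^-1) ^+ 2.
  by rewrite -{1}(sqr_sqrtr N0); field; rewrite gt_eqF.
by rewrite mulr_ge0 ?sqr_ge0// ltW.
Qed.

Let two_sqrt_eq s (N : R) : 0 < s -> 0 <= N -> s^-1 + s * N <= 2 * Num.sqrt N ->
  Num.sqrt N = s^-1.
Proof.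
move=> s0 N0; rewrite -subr_le0.
have -> : s^-1 + s * N - 2 * Num.sqrt N = s * (Num.sqrt N - s^-1) ^+ 2.
  by rewrite -{1}(sqr_sqrtr N0); field; rewrite gt_eqF.
rewrite pmulr_rle0// => le0; apply/eqP; rewrite -subr_eq0 -sqrf_eq0.
by rewrite eq_le le0 sqr_ge0.
Qed.

Definition cost (T : finType) (m : {ffun T -> R}) :=
  (p - 2) / p * (\sum_i m i `^ (p / (p - 2))).

(** The factor sqrt(s) turns s N(g) into N, which is how the parameter s enters
    Young's inequality. *)
Definition rescale s g : {ffun inode G -> R} := [ffun u => Num.sqrt s * g u].

Lemma mass_rescale s g : 0 <= s -> mass p (rescale s g) = s `^ (p / 2) * mass p g.
Proof.
move=> s0; rewrite massZ ger0_norm ?sqrtr_ge0// -powR12_sqrt// -powRrM.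
by rewrite [_ * p]mulrC.
Qed.

Lemma wmass_rescale nu s g : 0 <= s -> wmass nu (rescale s g) = s * wmass nu g.
Proof. by move=> s0; rewrite wmassZ sqr_sqrtr. Qed.

(** From 2 sqrt N <= 1 / s + s N and Young's inequality. For the bound on the energy
    s is l, and the last term is nonpositive. A smaller s leaves a negative
    multiple of the mass, which makes the gain coercive. *)
Lemma gain_le (hp : 2 < p) s nu g : 0 < s -> (forall u, 0 <= nu u) ->
  gain p nu g <=
    s^-1 + cost nu + 2 / p * (s `^ (p / 2) * mass p g - dirichlet p g).
Proof.
move=> s0 nu0; have H1 := two_sqrt_le s0 (wmass_ge0 g nu0).
have := @young_sum_le hp _ nu (rescale s g) nu0.
rewrite -/(wmass _ _) -/(cost _) -/(mass p _) mass_rescale ?wmass_rescale ?(ltW s0)//.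
rewrite /gain; lra.
Qed.

Lemma gain_eq (hp : 2 < p) s nu g : 0 < s -> (forall u, 0 <= nu u) ->
    s `^ (p / 2) * mass p g <= dirichlet p g ->
    s^-1 + cost nu <= gain p nu g ->
  [/\ Num.sqrt (wmass nu g) = s^-1, dirichlet p g <= s `^ (p / 2) * mass p g &
      forall u, nu u = `|rescale s g u| `^ (p - 2)].
Proof.
move=> s0 nu0 gD gE; have p0 : 0 < p by lra.
have H1 := two_sqrt_le s0 (wmass_ge0 g nu0).
have := @young_sum_le hp _ nu (rescale s g) nu0.
rewrite -/(wmass _ _) -/(cost _) -/(mass p _).
rewrite mass_rescale ?wmass_rescale ?(ltW s0)// => H2.
have c0 : 0 < 2 / p by rewrite divr_gt0.
have H3 : 2 / p * (s `^ (p / 2) * mass p g) <= 2 / p * dirichlet p g.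
  by rewrite ler_pM2l.
rewrite /gain in gE; split.
- by apply: two_sqrt_eq => //; [exact: wmass_ge0 | lra].
- by rewrite -(ler_pM2l c0); lra.
- apply: young_sum_eq => //; rewrite -/(wmass _ _) -/(cost _) -/(mass p _).
  by rewrite mass_rescale ?wmass_rescale ?(ltW s0)//; lra.
Qed.

Lemma gain_absf_le (hp : 2 < p) nu g : gain p nu g <= gain p nu (absf g).
Proof.
have p0 : 0 <= p by lra.
by rewrite /gain wmass_absf lerD2l lerN2 ler_wpM2l ?divr_ge0 ?dirichlet_absf_le.
Qed.

(** On small multiples of an indicator the square root, of degree 1, dominates the
    term of degree p. *)
Lemma gain_positive (hp : 2 < p) nu : Mplus nu -> nu != 0 ->
  exists g, 0 < gain p nu g.
Proof.
move=> nu0 nuN0; have p0 : 0 < p by lra.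
have [u nuu] : exists u, 0 < nu u.
  apply/not_existsP => H; case/eqP: nuN0; apply/ffunP => u; rewrite [RHS]ffunE.
  by apply/eqP; rewrite eq_le nu0 leNgt; have /negP -> := H u.
set D := dirichlet p (indicator u); have D0 : 0 <= D := dirichlet_ge0 _ _.
(* Chosen so that t^(p-1) D < sqrt (nu u). *)
pose t := (Num.sqrt (nu u) / (D + 1)) `^ (p - 1)^-1.
have s0 : 0 < Num.sqrt (nu u) by rewrite sqrtr_gt0.
have b0 : 0 < Num.sqrt (nu u) / (D + 1) by rewrite divr_gt0// ltr_wpDl.
have t0 : 0 < t by rewrite powR_gt0.
exists [ffun v => t * indicator u v]; rewrite /gain wmassZ dirichletZ -/D.
have -> : wmass nu (indicator u) = nu u.
  rewrite /wmass (bigD1 u)//= ffunE eqxx normr1 expr1n mulr1 big1 ?addr0// => v vu.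
  by rewrite ffunE (negbTE vu) normr0 expr0n mulr0.
rewrite sqrtrM ?sqr_ge0// sqrtr_sqr (gtr0_norm t0) -(mulr_powRB1 (ltW t0) p0).
have -> : t `^ (p - 1) = Num.sqrt (nu u) / (D + 1).
  by rewrite -powRrM mulVf ?powRr1 ?(ltW b0)// gt_eqF//; lra.
set S := Num.sqrt _ in s0 *.
have -> : 2 * (t * S) - 2 / p * (t * (S / (D + 1)) * D) =
    2 * (t * S) * (1 - p^-1 * (D / (D + 1))).
  by field; rewrite !gt_eqF// ltr_wpDl.
have D1 : 0 < D + 1 by rewrite ltr_wpDl.
have x1 : D / (D + 1) < 1 by rewrite ltr_pdivrMr// mul1r ltrDl.
have x0 : 0 <= D / (D + 1) by rewrite divr_ge0// ltW.
have q1 : p^-1 <= 1 by rewrite invf_le1//; lra.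
by rewrite !mulr_gt0// subr_gt0 (le_lt_trans _ x1)// ler_piMl.
Qed.

(** Functions of positive gain lie in a box, by coercivity, so a maximizer on the
    box is a global one. *)
Lemma gain_maximizer (hp : 2 < p) (l0 : R) nu :
    0 < l0 -> (forall g, l0 * mass p g <= dirichlet p g) -> Mplus nu -> nu != 0 ->
  exists g, [/\ forall u, 0 <= g u, 0 < wmass nu g &
                forall h, gain p nu h <= gain p nu g].
Proof.
move=> l00 l0min nu0 nuN0; have p0 : 0 < p by lra.
(* s^(p/2) is half the constant l0, to leave a negative multiple of the mass. *)
pose s := (l0 / 2) `^ (2 / p).
have s0 : 0 < s by rewrite powR_gt0// divr_gt0.
have sE : s `^ (p / 2) = l0 / 2.
  rewrite -powRrM (_ : 2 / p * (p / 2) = 1) ?powRr1//; last by field; rewrite gt_eqF.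
  by rewrite divr_ge0// ltW.
pose C := (s^-1 + cost nu) * p / l0.
pose r := C `^ p^-1.
have inbox h : 0 < gain p nu h -> forall u, `|h u| <= r.
  move=> h0 u; have := lt_le_trans h0 (gain_le hp h s0 nu0).
  rewrite sE => H1; have H2 := l0min h.
  have H3 : 2 / p * (l0 / 2 * mass p h - dirichlet p h) <= - (l0 / p * mass p h).
    have -> : - (l0 / p * mass p h) = 2 / p * (l0 / 2 * mass p h - l0 * mass p h).
      by field; rewrite gt_eqF.
    by rewrite ler_pM2l ?divr_gt0// lerD2l lerN2.
  have H4 : mass p h <= C.
    rewrite /C ler_pdivlMr// mulrC -ler_pdivrMr//.
    have -> : l0 * mass p h / p = l0 / p * mass p h by field; rewrite gt_eqF.
    by lra.
  rewrite -[leLHS](@powRrK _ _ p) ?normr_ge0 ?gt_eqF//.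
  apply: ge0_ler_powR; rewrite ?nnegrE ?powR_ge0 ?invr_ge0 ?(ltW p0)//.
    exact: le_trans (mass_ge0 _ _) H4.
  exact: le_trans (normr_powR_le_mass _ _ _) H4.
have Fc : coordwise_continuous (fun g => gain p nu g).
  apply: coordwise_continuousB; apply: coordwise_continuousM;
    try exact: coordwise_continuous_cst.
    apply: (coordwise_continuous_comp (@sqrt_continuous R)).
    exact: coordwise_continuous_wmass.
  exact: coordwise_continuous_dirichlet.
have [h1 h1pos] := gain_positive hp nu0 nuN0.
have Hc := @coordwise_continuous_cst R (inode G) 0.
have [g [_ gmax]] := box_constrained_max Fc Hc (inbox _ h1pos) erefl.
have gpos : 0 < gain p nu g.
  by apply: lt_le_trans h1pos (gmax _ (inbox _ h1pos) erefl).
exists (absf g); split => [u||h]; first by rewrite ffunE.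
  rewrite wmass_absf -sqrtr_gt0 -(@pmulr_rgt0 _ 2)//.
  apply: lt_le_trans gpos _; rewrite /gain lerBlDr lerDl mulr_ge0 ?dirichlet_ge0//.
  by rewrite divr_ge0// ltW.
apply: le_trans (gain_absf_le hp nu g).
have [h0|h0] := leP (gain p nu h) 0; first exact: le_trans h0 (ltW gpos).
exact: gmax (inbox _ h0) erefl.
Qed.

(** The bracket is the defect in Young's inequality between mu and grad g; it is
    kept because its vanishing determines mu. *)
Lemma energy_ge mu nu g : Mplus mu -> Mplus nu ->
  ((gain p nu g - cost nu + (cost mu + 2 / p * dirichlet p g - wdirichlet mu g))%:E
    <= energy p mu nu)%E.
Proof.
move=> mu0 nu0; rewrite /energy -!/(cost _).
have -> : gain p nu g - cost nu +
    (cost mu + 2 / p * dirichlet p g - wdirichlet mu g) =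
  2 * Num.sqrt (wmass nu g) - wdirichlet mu g + cost mu - cost nu.
  by rewrite /gain; ring.
rewrite EFinB EFinD; apply: leeD => //; apply: leeD => //.
exact: inv_lambda1_ge.
Qed.

Lemma energy_ge_gain (hp : 2 < p) mu nu g : Mplus mu -> Mplus nu ->
  ((gain p nu g - cost nu)%:E <= energy p mu nu)%E.
Proof.
move=> mu0 nu0; apply: le_trans (energy_ge g mu0 nu0).
rewrite lee_fin lerDl subr_ge0; exact: young_sum_le.
Qed.

Section Critical.
Variables (nu g : {ffun inode G -> R}).
Hypotheses (nu0 : Mplus nu) (N0 : 0 < wmass nu g) (g0 : forall u, 0 < g u).
Hypothesis gE : forall u, plap p g u = nu u / Num.sqrt (wmass nu g) * g u.

(** Test the equation of g against g. *)
Lemma dirichlet_critical (hp : 2 < p) : dirichlet p g = Num.sqrt (wmass nu g).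
Proof.
rewrite -plap_mulr_sum//; set k := Num.sqrt _.
have k0 : 0 < k by rewrite sqrtr_gt0.
apply: (mulfI (lt0r_neq0 k0)); rewrite -expr2 sqr_sqrtr ?(ltW N0)// mulr_sumr.
apply: eq_bigr => u _; rewrite gE -/k real_normK ?num_real//.
by field; rewrite gt_eqF.
Qed.

(** The upper bound is the inequality for positive eigenfunctions; the lower bound
    2 sqrt(N) - T is sqrt(N) at g, since T = sqrt(N). *)
Lemma inv_lambda1_critical (hp : 2 < p) :
  ((lambda1 (edge_weight p g) nu)^-1 = (Num.sqrt (wmass nu g))%:E)%E.
Proof.
have k0 : 0 < Num.sqrt (wmass nu g) by rewrite sqrtr_gt0.
apply/eqP; rewrite eq_le inv_lambda1_le//=; last exact: ground_state_inequality.
have := inv_lambda1_ge g (edge_weight_ge0 p g) nu0.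
rewrite wdirichlet_edge_weight// dirichlet_critical//.
by set k := Num.sqrt _; rewrite (_ : 2 * k - k = k)//; ring.
Qed.

Lemma energy_critical (hp : 2 < p) :
  energy p (edge_weight p g) nu = (gain p nu g - cost nu)%:E.
Proof.
rewrite /energy inv_lambda1_critical// -!/(cost _).
rewrite -EFinD; congr (_%:E).
have -> : cost (edge_weight p g) = (p - 2) / p * dirichlet p g.
  congr (_ * _); apply: eq_bigr => e _; rewrite ffunE -powRrM.
  by congr (_ `^ _); field; rewrite !lt0r_neq0//; lra.
by rewrite /gain dirichlet_critical//; field; rewrite lt0r_neq0//; lra.
Qed.

Lemma min_energy_critical (hp : 2 < p) :
  min_energy p nu = (gain p nu g - cost nu)%:E.
Proof.
apply/eqP; rewrite eq_le; apply/andP; split.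
  rewrite -energy_critical//; apply: ereal_inf_lbound.
  by exists (edge_weight p g) => //; exact: edge_weight_ge0.
by apply: le_ereal_inf_tmp => _ [mu mu0 <-]; exact: energy_ge_gain.
Qed.

End Critical.

End Energy.

(** * The saddle point of a normalized first p-eigenfunction *)
Section SaddlePoint.
Context {R : realType} (G : wgraph R) (p l : R) (f : {ffun inode G -> R}).
Implicit Types (g h nu : {ffun inode G -> R}) (mu : {ffun oedge G -> R}).

Definition node_weight : {ffun inode G -> R} :=
  [ffun u => `|rescale l f u| `^ (p - 2)].

(** l is the first p-eigenvalue to the power 2/p. The scale of f is the one for
    which sqrt(N) = 1 / l, the equality case of 2 sqrt N <= 1 / l + l N, when nu is
    [node_weight]. *)
Definition normalized_ground_state :=
  [/\ 0 < l, forall g, l `^ (p / 2) * mass p g <= dirichlet p g,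
      forall u, 0 <= f u, l `^ (p / 2) * mass p f = l^-1 & dirichlet p f = l^-1].

Hypothesis fP : normalized_ground_state.

Lemma node_weight_ge0 : Mplus node_weight.
Proof. by move=> u; rewrite ffunE powR_ge0. Qed.

Lemma wmass_node_weight (hp : 2 < p) : wmass node_weight f = (l^-1) ^+ 2.
Proof.
have [l0 _ _ fm _] := fP.
apply: (mulfI (lt0r_neq0 l0)); rewrite -wmass_rescale ?(ltW l0)//.
rewrite expr2 mulrA mulfV ?lt0r_neq0// mul1r -fm -mass_rescale ?(ltW l0)//.
apply: eq_bigr => u _; rewrite ffunE -powR_mulrn// -powRD ?subrK//.
by apply/implyP => /eqP; lra.
Qed.

Lemma sqrt_wmass_node_weight (hp : 2 < p) :
  Num.sqrt (wmass node_weight f) = l^-1.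
Proof.
have [l0 _ _ _ _] := fP.
by rewrite wmass_node_weight// sqrtr_sqr ger0_norm// invr_ge0 ltW.
Qed.

Lemma wmass_node_weight_gt0 (hp : 2 < p) : 0 < wmass node_weight f.
Proof.
by have [l0 _ _ _ _] := fP; rewrite wmass_node_weight// exprn_gt0// invr_gt0.
Qed.

Lemma gain_node_weight (hp : 2 < p) :
  gain p node_weight f = l^-1 + cost p node_weight.
Proof.
have [l0 _ _ fm fD] := fP.
have -> : cost p node_weight = (p - 2) / p * l^-1.
  congr (_ * _); rewrite -fm -mass_rescale ?(ltW l0)//.
  apply: eq_bigr => u _; rewrite ffunE -powRrM; congr (_ `^ _).
  by field; rewrite lt0r_neq0//; lra.
rewrite /gain sqrt_wmass_node_weight// fD; field.
by rewrite !lt0r_neq0//; lra.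
Qed.

Lemma gain_le_node_weight (hp : 2 < p) nu g : Mplus nu ->
  gain p nu g <= l^-1 + cost p nu.
Proof.
move=> nu0; have [l0 lmin _ _ _] := fP.
apply: le_trans (gain_le hp g l0 nu0) _.
rewrite gerDl mulr_ge0_le0 ?subr_le0// divr_ge0//; lra.
Qed.

(** f attains the upper bound for the gain of its own weight, so the Euler-Lagrange
    equation of the gain applies to f. *)
Lemma plap_ground_state (hp : 2 < p) u :
  plap p f u = node_weight u / Num.sqrt (wmass node_weight f) * f u.
Proof.
apply: gain_euler_lagrange => //; [exact: node_weight_ge0|exact: wmass_node_weight_gt0|].
by move=> h; rewrite gain_node_weight//; apply: gain_le_node_weight => //;
  exact: node_weight_ge0.
Qed.

(** Separates the power of l, to recognize the eigenvalue in the equation of f. *)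
Lemma node_weightE (hp : 2 < p) u :
  node_weight u = l `^ ((p - 2) / 2) * `|f u| `^ (p - 2).
Proof.
have [l0 _ _ _ _] := fP; rewrite !ffunE normrM powRM//.
rewrite ger0_norm ?sqrtr_ge0// -powR12_sqrt ?(ltW l0)// -powRrM.
by rewrite [2^-1 * _]mulrC.
Qed.

Lemma p_laplace_ground_state (hp : 2 < p) u :
  plap p f u = l `^ (p / 2) * (`|f u| `^ (p - 2) * f u).
Proof.
have [l0 _ _ _ _] := fP.
rewrite plap_ground_state// sqrt_wmass_node_weight// invrK node_weightE//.
have -> : l `^ (p / 2) = l `^ ((p - 2) / 2 + 1) by congr (_ `^ _); field.
rewrite (@powRD _ l) ?(gt_eqF l0) ?implybT// powRr1 ?(ltW l0)//.
by ring.
Qed.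

Lemma ground_state_neq0 (hp : 2 < p) : f != 0.
Proof.
have [l0 _ _ fm _] := fP; apply/eqP => f0.
have p0 : p != 0 by rewrite gt_eqF//; lra.
by move: fm; rewrite f0 mass0// mulr0 => /esym/eqP; rewrite invr_eq0 gt_eqF.
Qed.

Lemma node_weight_neq0 (hp : 2 < p) : node_weight != 0.
Proof.
apply/eqP => nuE; have := wmass_node_weight_gt0 hp; rewrite nuE.
by rewrite /wmass big1 ?ltxx// => u _; rewrite ffunE mul0r.
Qed.

Hypothesis hconn : graph_connected G.

Lemma ground_state_gt0 (hp : 2 < p) u : 0 < f u.
Proof.
have [_ _ f0 _ _] := fP.
apply: (@strong_maximum_principle _ _ hconn p
  [ffun v => node_weight v / Num.sqrt (wmass node_weight f)]) => //.
  exact: ground_state_neq0.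
by apply/ffunP => v; rewrite [RHS]ffunE [in RHS]ffunE plap_ground_state.
Qed.

Lemma min_energy_maximizer (hp : 2 < p) nu : Mplus nu -> nu != 0 -> exists g,
  [/\ forall u, 0 < g u, forall h, gain p nu h <= gain p nu g &
      min_energy p nu = (gain p nu g - cost p nu)%:E].
Proof.
move=> nu0 nuN0; have [l0 lmin _ _ _] := fP.
have [g [g0 N0 gmax]] := gain_maximizer hp (powR_gt0 _ l0) lmin nu0 nuN0.
have gE := gain_euler_lagrange hp nu0 N0 gmax.
have gpos u : 0 < g u.
  apply: (@strong_maximum_principle _ _ hconn p
    [ffun v => nu v / Num.sqrt (wmass nu g)]) => //.
    apply/eqP => gz; move: N0; rewrite gz /wmass big1 ?ltxx// => v _.
    by rewrite ffunE normr0 expr0n mulr0.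
  by apply/ffunP => v; rewrite [RHS]ffunE [in RHS]ffunE gE.
by exists g; split => //; exact: min_energy_critical.
Qed.

Lemma min_energy_node_weight (hp : 2 < p) : min_energy p node_weight = (l^-1)%:E.
Proof.
rewrite (min_energy_critical node_weight_ge0 (wmass_node_weight_gt0 hp)
  (ground_state_gt0 hp) (plap_ground_state hp) hp).
by rewrite gain_node_weight// addrK.
Qed.

Lemma saddle_point_node_weight (hp : 2 < p) :
  saddle_point p (edge_weight p f, node_weight).
Proof.
have e0 := edge_weight_ge0 p f; have n0 := node_weight_ge0.
split => //; first exact: node_weight_neq0.
- move=> nu nu0 nuN0; rewrite min_energy_node_weight//.
  have [g [_ _ ->]] := min_energy_maximizer hp nu0 nuN0.
  by rewrite lee_fin lerBlDr gain_le_node_weight.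
- move=> mu mu0.
  rewrite (energy_critical node_weight_ge0 (wmass_node_weight_gt0 hp)
    (ground_state_gt0 hp) (plap_ground_state hp) hp).
  exact: energy_ge_gain.
Qed.

Lemma ground_state_multiple (hp : 2 < p) g :
  dirichlet p g <= l `^ (p / 2) * mass p g -> exists c : R, forall u, g u = c * f u.
Proof.
apply: ground_state_unique => //; first exact: ground_state_gt0.
move=> u; rewrite p_laplace_ground_state//.
by rewrite -(signed_powR_ge0 hp) ?(ltW (ground_state_gt0 hp _)).
Qed.

(** An optimal nu reaches the value 1 / l, so its gain maximizer g is a multiple
    c f, and |c| = 1 because both have the same mass. Then nu is the node weight of f.
    For mu, the minimality leaves no defect in Young's inequality against f. *)
Lemma saddle_point_unique (hp : 2 < p) mu nu : saddle_point p (mu, nu) ->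
  mu = edge_weight p f /\ nu = node_weight.
Proof.
move=> [nu0 nuN0 numax mu0 mumin]; have [l0 lmin _ fm _] := fP.
have n0 := node_weight_ge0; have p0 : 0 < p by lra.
have lp0 : 0 < l `^ (p / 2) by rewrite powR_gt0.
have nuE : nu = node_weight.
  have [g [g0 gmax gE]] := min_energy_maximizer hp nu0 nuN0.
  have := numax _ n0 (node_weight_neq0 hp).
  rewrite gE min_energy_node_weight// lee_fin lerBrDr.
  move=> /(gain_eq hp l0 nu0 (lmin g))[gN gD nuE].
  have [c cE] := ground_state_multiple hp gD.
  have gm : l `^ (p / 2) * mass p g = l^-1.
    rewrite -mass_rescale ?(ltW l0)//.
    have -> : mass p (rescale l g) = wmass nu (rescale l g).
      apply: eq_bigr => u _; rewrite nuE -powR_mulrn// -powRD ?subrK//.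
      by apply/implyP => /eqP; lra.
    rewrite wmass_rescale ?(ltW l0)// -[wmass _ _]sqr_sqrtr ?wmass_ge0// gN expr2.
    by rewrite mulrA mulfV ?lt0r_neq0// mul1r.
  have c1 : `|c| = 1.
    have gcf : g = [ffun u => c * f u] by apply/ffunP => u; rewrite ffunE.
    have : `|c| `^ p = 1.
      have m0 : mass p f != 0.
        by rewrite gt_eqF// mass_gt0// ground_state_neq0.
      apply: (mulIf m0); apply: (mulfI (lt0r_neq0 lp0)).
      by rewrite -massZ -gcf mul1r gm fm.
    by move=> cp; rewrite -(@powRrK _ `|c| p) ?gt_eqF// cp powR1.
  apply/ffunP => u; rewrite nuE [RHS]ffunE; congr (_ `^ _).
  by rewrite !ffunE cE !normrM c1 mul1r.
split => //; move: mumin; rewrite nuE => mumin.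
have := mumin _ (edge_weight_ge0 p f).
rewrite (energy_critical node_weight_ge0 (wmass_node_weight_gt0 hp)
  (ground_state_gt0 hp) (plap_ground_state hp) hp).
move=> /(le_trans (energy_ge p f mu0 n0)).
rewrite lee_fin gerDl subr_le0 => H.
by apply/ffunP => e; rewrite [RHS]ffunE; exact: (young_sum_eq hp mu0 H).
Qed.

Lemma lambda1_saddle_point (hp : 2 < p) :
  lambda1 (edge_weight p f) node_weight = l%:E.
Proof.
have [l0 _ _ _ _] := fP; rewrite -[LHS]inveK.
rewrite (inv_lambda1_critical node_weight_ge0 (wmass_node_weight_gt0 hp)
  (ground_state_gt0 hp) (plap_ground_state hp) hp).
by rewrite sqrt_wmass_node_weight// inver invr_eq0 gt_eqF// invrK.
Qed.

Lemma weighted_eigenpair_saddle_point (hp : 2 < p) :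
  weighted_eigenpair (edge_weight p f) node_weight l f.
Proof.
split; first exact: ground_state_neq0.
rewrite lap_edge_weight; apply/ffunP => u.
rewrite plap_ground_state// sqrt_wmass_node_weight// invrK -mulrA mulrCA.
by rewrite [RHS]ffunE [diag_nu _ _ u]ffunE.
Qed.

Lemma first_p_eigenpair_ground_state (hp : 2 < p) :
  first_p_eigenpair p (l `^ (p / 2)) f.
Proof.
have [l0 lmin _ fm fD] := fP; have fN0 := ground_state_neq0 hp.
split.
- by split=> //; apply/ffunP => u; rewrite p_laplace_ground_state// [RHS]ffunE.
- rewrite /rayleigh -/(dirichlet p f) -/(mass p f) fD -fm mulfK//.
  by rewrite gt_eqF// mass_gt0.
- move=> g gN0; rewrite /rayleigh -/(dirichlet p g) -/(mass p g).
  by rewrite ler_pdivlMr ?mass_gt0.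
- move=> g gN0; rewrite /rayleigh -/(dirichlet p g) -/(mass p g) => gE.
  have [|c cE] := @ground_state_multiple hp g.
    by rewrite -gE divfK// gt_eqF// mass_gt0.
  have gcf : g = c *: f by apply/ffunP => u; rewrite cE [RHS]ffunE.
  by exists c => //; apply: contra gN0 => /eqP c0; rewrite gcf c0 scale0r.
Qed.

End SaddlePoint.

Lemma normalized_ground_state_exists (R : realType) (G : wgraph R) (p : R) :
    2 < p -> graph_connected G -> boundary G != finset.set0 ->
  exists l (f : {ffun inode G -> R}), normalized_ground_state p l f.
Proof.
move=> hp hconn hB; have p0 : 0 < p by lra.
have [f1 [f10 f1m f1min]] := dirichlet_minimizer hconn hB hp.
set lam := dirichlet p f1 in f1min.
have lam0 : 0 < lam.
  apply: dirichlet_gt0 => //; apply/eqP => f1z.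
  by move: f1m; rewrite f1z mass0 ?gt_eqF// => /esym/eqP; rewrite oner_eq0.
pose l := lam `^ (2 / p).
have l0 : 0 < l by rewrite powR_gt0.
have lE : l `^ (p / 2) = lam.
  rewrite -powRrM (_ : 2 / p * (p / 2) = 1) ?powRr1 ?(ltW lam0)//.
  by field; rewrite gt_eqF.
pose t := (l^-1 / lam) `^ p^-1.
have tE : `|t| `^ p = l^-1 / lam.
  rewrite ger0_norm ?powR_ge0// -powRrM mulVf ?gt_eqF// powRr1//.
  by rewrite divr_ge0 ?invr_ge0 ?ltW.
exists l, [ffun u => t * f1 u]; split => //.
- by move=> g; rewrite lE.
- by move=> u; rewrite ffunE mulr_ge0 ?powR_ge0.
- by rewrite lE massZ tE f1m mulr1 mulrC divfK// gt_eqF.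
- by rewrite dirichletZ tE -/lam divfK// gt_eqF.
Qed.

Unset Implicit Arguments.

Theorem theorem4p2 (R : realType) (G : wgraph R) (p : R) (hp : 2 < p)
  (hconn : graph_connected G) (hB : boundary G != finset.set0) :
  (exists! s, saddle_point (G := G) p s) /\
  (forall (mu : {ffun oedge G -> R}) (nu : {ffun inode G -> R}),
     saddle_point p (mu, nu) ->
     exists l : R, lambda1 mu nu = l%:E /\
       exists f : {ffun inode G -> R},
         weighted_eigenpair mu nu l f /\ first_p_eigenpair p (l `^ (p / 2)) f).
Proof.
have [l [f fP]] := normalized_ground_state_exists hp hconn hB.
split.
  exists (edge_weight p f, node_weight p l f); split.
    exact: saddle_point_node_weight.
  by move=> [mu nu] /(saddle_point_unique fP hconn hp)[-> ->].
move=> mu nu /(saddle_point_unique fP hconn hp)[-> ->]; exists l.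
split; first exact: lambda1_saddle_point.
exists f; split; first exact: weighted_eigenpair_saddle_point.
exact: first_p_eigenpair_ground_state.
Qed.
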